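(* Let $A$ be a ring such that the inclusion functor $e_* : \mathsf{E}(A) \to \mathsf{K}(\mathsf{Pro}\,A)$ has a right adjoint $e^! : \mathsf{K}(\mathsf{Pro}\,A) \to \mathsf{E}(A)$. Let $M$ and $N$ be left $A$-modules. If $$0 \to M' \to M \to M'' \to 0 \quad\text{and}\quad 0 \to N' \to N \to N'' \to 0$$ are short exact sequences of left $A$-modules, then there are natural long exact sequences $$\cdots \to \widehat{\operatorname{Ext}}^i(M'',N) \to \widehat{\operatorname{Ext}}^i(M,N) \to \widehat{\operatorname{Ext}}^i(M',N) \to \cdots$$ and $$\cdots \to \widehat{\operatorname{Ext}}^i(M,N') \to \widehat{\operatorname{Ext}}^i(M,N) \to \widehat{\operatorname{Ext}}^i(M,N'') \to \cdots .$$
   Context: Complexes are written cohomologically and may be unbounded. For a complex $X$ and a module $N$, $\operatorname{Hom}_A(X,N)$ is the complex with $\operatorname{Hom}_A(X^{-i},N)$ in cohomological degree $i$. $\mathsf{K}(\mathsf{Pro}\,A)$ is the homotopy category of complexes of projective left $A$-modules. $\mathsf{E}(A)$ is the class of complexes $E$ of left $A$-modules such that $E$ consists of projective modules, $E$ is exact, and $\operatorname{Hom}_A(E,Q)$ is exact for each projective left $A$-module $Q$. It is viewed as a full subcategory of $\mathsf{K}(\mathsf{Pro}\,A)$, with inclusion functor $e_*$. $\operatorname{res} : \mathsf{Mod}(A) \to \mathsf{K}(\mathsf{Pro}\,A)$ is a functor sending each left $A$-module to a projective resolution of it (concentrated in non-positive cohomological degrees), giving an equivalence of $\mathsf{Mod}(A)$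 with the full subcategory of projective resolutions. Tate Ext groups, for left $A$-modules $M,N$ and $i \in \mathbb{Z}$: $\widehat{\operatorname{Ext}}^i(M,N) = \operatorname{H}^i \operatorname{Hom}_A(e^! \operatorname{res} M, N)$. *)

(* Defs.v *)
From HB Require Import structures.
From mathcomp Require Import all_boot all_order all_algebra.
From mathcomp Require Import ring_quotient.
From mathcomp Require Import boolp.

Set Implicit Arguments.
Unset Strict Implicit.
Unset Printing Implicit Defensive.

Import GRing.Theory.
Local Open Scope ring_scope.
Local Open Scope quotient_scope.

(* Hom-sets carry an explicit congruence [heq] which plays the role of equality
   of morphisms, so that a homotopy category has chain maps as morphisms and
   homotopy as [heq]. *)
Record category := Category {
  obj :> Type;
  hom : obj -> obj -> Type;
  heq : forall X Y, hom X Y -> hom X Y -> Prop;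
  idm : forall X, hom X X;
  mcomp : forall X Y Z, hom Y Z -> hom X Y -> hom X Z;
  heq_refl : forall X Y (f : hom X Y), heq f f;
  heq_sym : forall X Y (f g : hom X Y), heq f g -> heq g f;
  heq_trans : forall X Y (f g h : hom X Y), heq f g -> heq g h -> heq f h;
  comp_heq : forall X Y Z (f f' : hom Y Z) (g g' : hom X Y),
    heq f f' -> heq g g' -> heq (mcomp f g) (mcomp f' g');
  comp_idl : forall X Y (f : hom X Y), heq (mcomp (idm Y) f) f;
  comp_idr : forall X Y (f : hom X Y), heq (mcomp f (idm X)) f;
  comp_assoc : forall X Y Z W (f : hom Z W) (g : hom Y Z) (h : hom X Y),
    heq (mcomp f (mcomp g h)) (mcomp (mcomp f g) h)
}.

Arguments hom {c} X Y.
Arguments heq {c X Y} f g.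
Arguments idm {c} X.
Arguments mcomp {c X Y Z} f g.

Record functor (C D : category) := Functor {
  fobj :> C -> D;
  fmap : forall X Y : C, hom X Y -> hom (fobj X) (fobj Y);
  fmap_heq : forall (X Y : C) (f g : hom X Y), heq f g -> heq (fmap f) (fmap g);
  fmap_id : forall X : C, heq (fmap (idm X)) (idm (fobj X));
  fmap_comp : forall (X Y Z : C) (f : hom Y Z) (g : hom X Y),
    heq (fmap (mcomp f g)) (mcomp (fmap f) (fmap g))
}.

Arguments fmap {C D} _ {X Y} _.

(* [adjunction F G]: F is left adjoint to G. *)
Record adjunction (C D : category) (F : functor C D) (G : functor D C) :=
  Adjunction {
  adj : forall (X : C) (Y : D), hom (F X) Y -> hom X (G Y);
  adj_inv : forall (X : C) (Y : D), hom X (G Y) -> hom (F X) Y;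
  adj_heq : forall (X : C) (Y : D) (f g : hom (F X) Y),
    heq f g -> heq (adj f) (adj g);
  adj_inv_heq : forall (X : C) (Y : D) (f g : hom X (G Y)),
    heq f g -> heq (adj_inv f) (adj_inv g);
  adjK : forall (X : C) (Y : D) (f : hom (F X) Y), heq (adj_inv (adj f)) f;
  adj_invK : forall (X : C) (Y : D) (f : hom X (G Y)), heq (adj (adj_inv f)) f;
  adj_natural : forall (X X' : C) (Y Y' : D)
      (h : hom X' X) (f : hom (F X) Y) (g : hom Y Y'),
    heq (adj (mcomp g (mcomp f (fmap F h)))) (mcomp (fmap G g) (mcomp (adj f) h))
}.

Section FullSubcategory.
Variables (C : category) (P : C -> Prop).

Definition full_subcategory : category :=
  @Category {X : C | P X} (fun X Y => hom (sval X) (sval Y))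
    (fun X Y f g => heq f g) (fun X => idm (sval X)) (fun X Y Z f g => mcomp f g)
    (fun X Y f => heq_refl f) (fun X Y f g => @heq_sym C _ _ f g)
    (fun X Y f g h => @heq_trans C _ _ f g h)
    (fun X Y Z f f' g g' => @comp_heq C _ _ _ f f' g g')
    (fun X Y f => comp_idl f) (fun X Y f => comp_idr f)
    (fun X Y Z W f g h => comp_assoc f g h).

Definition inclusion : functor full_subcategory C :=
  @Functor full_subcategory C (fun X => sval X) (fun X Y f => f)
    (fun X Y f g e => e) (fun X => heq_refl _) (fun X Y Z f g => heq_refl _).

End FullSubcategory.

(* The differential is given between any two degrees and vanishes except from
   degree i to degree i + 1; this avoids transports along equalities between
   degrees such as - (i + 1) + 1 = - i. *)
Record abcomplex := AbComplex {
  abobj :> int -> zmodType;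
  abd : forall i j, {additive abobj i -> abobj j};
  abd_shape : forall i j, j != i + 1 -> forall x, abd i j x = 0;
  abdd : forall i j k x, abd j k (abd i j x) = 0
}.

Arguments abd a i j : clear implicits.

Definition exact_complex (C : abcomplex) :=
  forall (i : int) (x : C i),
    abd C i (i + 1) x = 0 -> exists y : C (i - 1), abd C (i - 1) i y = x.

Record abmap (C D : abcomplex) := AbMap {
  abmap_fun :> forall i, {additive C i -> D i};
  abmapP : forall i j x, abmap_fun j (abd C i j x) = abd D i j (abmap_fun i x)
}.

Section Cohomology.
Variables (C : abcomplex) (i : int).

Definition is_cocycle : {pred C i} := fun x => abd C i (i + 1) x == 0.

Fact is_cocycle_zmod : zmod_closed is_cocycle.
Proof.
split=> [|x y]; rewrite !unfold_in; first by rewrite raddf0.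
by move=> /eqP x0 /eqP y0; rewrite raddfB x0 y0 subr0.
Qed.
HB.instance Definition _ := GRing.isZmodClosed.Build (C i) is_cocycle
  is_cocycle_zmod.

Record cocycle := Cocycle {
  cocycle_val :> C i;
  cocycleP : cocycle_val \in is_cocycle
}.
HB.instance Definition _ := [isSub for cocycle_val].
HB.instance Definition _ := [Choice of cocycle by <:].
HB.instance Definition _ := [SubChoice_isSubZmodule of cocycle by <:].

Definition is_coboundary : {pred cocycle} :=
  fun z => `[< exists y : C (i - 1), abd C (i - 1) i y = cocycle_val z >].

Fact is_coboundary_zmod : zmod_closed is_coboundary.
Proof.
split=> [|x y]; rewrite !unfold_in /is_coboundary.
  by apply/asboolP; exists 0; rewrite raddf0.
move=> /asboolP[x' hx] /asboolP[y' hy]; apply/asboolP; exists (x' - y').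
by rewrite raddfB hx hy.
Qed.
HB.instance Definition _ := GRing.isZmodClosed.Build cocycle is_coboundary
  is_coboundary_zmod.

Definition cohomology : zmodType := {ideal_quot is_coboundary}.

Definition cohomology_class (z : cocycle) : cohomology :=
  \pi_{ideal_quot is_coboundary} z.

End Cohomology.

Section CohomologyMap.
Variables (C D : abcomplex) (f : abmap C D) (i : int).

Fact cocycle_map_subproof (z : cocycle C i) :
  f i (cocycle_val z) \in @is_cocycle D i.
Proof.
by have /eqP hx := cocycleP z; rewrite unfold_in /= -abmapP hx raddf0.
Qed.

Definition cocycle_map (z : cocycle C i) : cocycle D i :=
  Cocycle (cocycle_map_subproof z).

Definition cohomology_map (h : cohomology C i) : cohomology D i :=
  cohomology_class (cocycle_map (repr (h : {ideal_quot @is_coboundary C i}))).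

Lemma cohomology_map_class (z : cocycle C i) :
  cohomology_map (cohomology_class z) = cohomology_class (cocycle_map z).
Proof.
rewrite /cohomology_map /cohomology_class.
have: repr (\pi_{ideal_quot @is_coboundary C i} z) - z \in @is_coboundary C i.
  by rewrite Quotient.idealrBE reprK.
rewrite unfold_in /is_coboundary => /asboolP[y hy]; apply/eqP.
rewrite -Quotient.idealrBE unfold_in /is_coboundary; apply/asboolP.
by exists (f (i - 1) y); rewrite -abmapP hy raddfB.
Qed.

Fact cohomology_map_is_additive : zmod_morphism cohomology_map.
Proof.
move=> g h; rewrite -[g]reprK -[h]reprK.
set x := repr g; set y := repr h.
have cB (E : abcomplex) (u v : cocycle E i) :
    cohomology_class u - cohomology_class v = cohomology_class (u - v).
  by rewrite /cohomology_class raddfB.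
rewrite -![\pi_ _ _]/(cohomology_class _) cB !cohomology_map_class cB.
by congr cohomology_class; apply: val_inj; rewrite /= raddfB.
Qed.
HB.instance Definition _ := GRing.isZmodMorphism.Build
  (cohomology C i) (cohomology D i) cohomology_map cohomology_map_is_additive.

End CohomologyMap.

(* [lmodType A] is the type of left A-modules; [pzRingType] is the structure of
   unital associative rings, the zero ring included. *)

Section LinearHom.
Variables (A : pzRingType) (U V : lmodType A).

Lemma linear_ext (f g : {linear U -> V}) : f =1 g -> f = g.
Proof.
case: f g => [f [[af] [lf]]] [g [[ag] [lg]]] /= /funext e.
subst g; congr (GRing.Linear.Pack (GRing.Linear.Class _ _)).
  by congr (_ _); apply: Prop_irrelevance.
by congr (_ _); apply: Prop_irrelevance.
Qed.

(* The abelian group Hom_A(U, V) under pointwise addition. *)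
Definition linhom := {linear U -> V}.
HB.instance Definition _ := gen_eqMixin linhom.
HB.instance Definition _ := gen_choiceMixin linhom.

Definition linhom_zero : linhom := \0 : U -> V.
Definition linhom_opp (f : linhom) : linhom :=
  (\- (f : U -> V)).
Definition linhom_add (f g : linhom) : linhom :=
  ((f : U -> V) \+ (g : U -> V)).

Fact linhom_addA : associative linhom_add.
Proof. by move=> f g h; apply: linear_ext => x /=; rewrite addrA. Qed.
Fact linhom_addC : commutative linhom_add.
Proof. by move=> f g; apply: linear_ext => x /=; rewrite addrC. Qed.
Fact linhom_add0 : left_id linhom_zero linhom_add.
Proof. by move=> f; apply: linear_ext => x /=; rewrite add0r. Qed.
Fact linhom_addN : left_inverse linhom_zero linhom_opp linhom_add.
Proof. by move=> f; apply: linear_ext => x /=; rewrite addNr. Qed.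
HB.instance Definition _ := GRing.isZmodule.Build linhom
  linhom_addA linhom_addC linhom_add0 linhom_addN.

End LinearHom.

Definition lin_id (A : pzRingType) (U : lmodType A) : {linear U -> U} :=
  @idfun U.

Definition lin_comp (A : pzRingType) (U V W : lmodType A)
    (g : {linear V -> W}) (f : {linear U -> V}) : {linear U -> W} :=
  g \o f.

Section LinearHomMaps.
Variables (A : pzRingType) (U V W : lmodType A).

Definition precomp (f : {linear U -> V}) (g : linhom V W) : linhom U W :=
  lin_comp g f.
Fact precomp_is_additive f : zmod_morphism (precomp f).
Proof. by move=> g h; apply: linear_ext. Qed.
HB.instance Definition _ f := GRing.isZmodMorphism.Build
  (linhom V W) (linhom U W) (precomp f) (precomp_is_additive f).

Definition postcomp (g : {linear V -> W}) (f : linhom U V) : linhom U W :=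
  lin_comp g f.
Fact postcomp_is_additive g : zmod_morphism (postcomp g).
Proof. by move=> f h; apply: linear_ext => x /=; rewrite raddfB. Qed.
HB.instance Definition _ g := GRing.isZmodMorphism.Build
  (linhom U V) (linhom U W) (postcomp g) (postcomp_is_additive g).

End LinearHomMaps.

Arguments precomp {A U V} W f.
Arguments postcomp {A} U {V W} g.

Definition projective (A : pzRingType) (P : lmodType A) :=
  forall (U V : lmodType A) (g : {linear U -> V}) (f : {linear P -> V}),
    (forall v, exists u, g u = v) ->
    exists h : {linear P -> U}, forall x, g (h x) = f x.

Definition Mod (A : pzRingType) : category.
Proof.
refine (@Category (lmodType A) (fun M N => {linear M -> N})
  (fun M N f g => f =1 g) (@lin_id A) (@lin_comp A) _ _ _ _ _ _ _) => //.
- by move=> M N f g e x; rewrite e.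
- by move=> M N f g h e e' x; rewrite e e'.
- by move=> M N L f f' g g' e e' x /=; rewrite e e'.
Defined.

Record ses (A : pzRingType) := Ses {
  ses_sub : lmodType A;
  ses_mid : lmodType A;
  ses_quo : lmodType A;
  ses_inj : {linear ses_sub -> ses_mid};
  ses_proj : {linear ses_mid -> ses_quo};
  ses_inj_inj : injective ses_inj;
  ses_exact : forall m, ses_proj m = 0 <-> exists m', ses_inj m' = m;
  ses_proj_surj : forall m'', exists m, ses_proj m = m''
}.

Record ses_hom (A : pzRingType) (S T : ses A) := SesHom {
  ses_hom_sub : {linear ses_sub S -> ses_sub T};
  ses_hom_mid : {linear ses_mid S -> ses_mid T};
  ses_hom_quo : {linear ses_quo S -> ses_quo T};
  ses_hom_inj : forall x, ses_inj T (ses_hom_sub x) = ses_hom_mid (ses_inj S x);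
  ses_hom_proj : forall x, ses_proj T (ses_hom_mid x) = ses_hom_quo (ses_proj S x)
}.

Record complex (A : pzRingType) := Complex {
  cobj :> int -> lmodType A;
  cd : forall i j, {linear cobj i -> cobj j};
  cd_shape : forall i j, j != i + 1 -> forall x, cd i j x = 0;
  cdd : forall i j k x, cd j k (cd i j x) = 0
}.

Arguments cd {A} c i j : rename.

Record chain_map (A : pzRingType) (X Y : complex A) := ChainMap {
  chain_fun :> forall i, {linear X i -> Y i};
  chain_mapP : forall i j x, chain_fun j (cd X i j x) = cd Y i j (chain_fun i x)
}.

Definition chain_id (A : pzRingType) (X : complex A) : chain_map X X :=
  @ChainMap A X X (fun i => lin_id (X i)) (fun i j x => erefl).

Definition chain_comp (A : pzRingType) (X Y Z : complex A)
  (g : chain_map Y Z) (f : chain_map X Y) : chain_map X Z.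
Proof.
exists (fun i => lin_comp (g i) (f i)).
by move=> i j x /=; rewrite !chain_mapP.
Defined.

Definition homotopic (A : pzRingType) (X Y : complex A) (f g : chain_map X Y) :=
  exists s : forall i j, {linear X i -> Y j}, forall i x,
    f i x - g i x =
      cd Y (i - 1) i (s i (i - 1) x) + s (i + 1) i (cd X i (i + 1) x).

Definition underlying (A : pzRingType) (X : complex A) : abcomplex :=
  @AbComplex (fun i => X i) (fun i j => cd X i j) (@cd_shape A X) (@cdd A X).

Section HomComplex.
Variable A : pzRingType.

(* Hom_A(X, N), with Hom_A(X^{-i}, N) in degree i. The differential is
   precomposition with that of X, without sign: signs depending only on the
   degree change neither cocycles nor coboundaries. *)
Definition homcx (X : complex A) (N : lmodType A) : abcomplex.
Proof.
refine (@AbComplex (fun i => linhom (X (- i)) N)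
  (fun i j => precomp N (cd X (- j) (- i))) _ _).
- move=> i j ne f; apply: linear_ext => x /=; rewrite cd_shape ?raddf0 //.
  apply: contra ne => /eqP e.
  by rewrite -[j]opprK -[i]opprK e opprD subrK.
- by move=> i j k f; apply: linear_ext => x /=; rewrite cdd raddf0.
Defined.

Definition homcx_mapl (X Y : complex A) (f : chain_map X Y) (N : lmodType A) :
  abmap (homcx Y N) (homcx X N).
Proof.
refine (@AbMap (homcx Y N) (homcx X N) (fun i => precomp N (f (- i))
  : {additive linhom (Y (- i)) N -> linhom (X (- i)) N}) _).
by move=> i j g; apply: linear_ext => x /=; rewrite chain_mapP.
Defined.

Definition homcx_mapr (X : complex A) (N N' : lmodType A) (u : {linear N -> N'}) :
  abmap (homcx X N) (homcx X N').
Proof.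
refine (@AbMap (homcx X N) (homcx X N') (fun i => postcomp (X (- i)) u
  : {additive linhom (X (- i)) N -> linhom (X (- i)) N'}) _).
by move=> i j g; apply: linear_ext.
Defined.

End HomComplex.

Section HomotopyCategory.
Variable A : pzRingType.

Record procomplex := ProComplex {
  pro_cx :> complex A;
  pro_projective : forall i, projective (pro_cx i)
}.

Definition KPro : category.
Proof.
refine (@Category procomplex (fun X Y => chain_map X Y)
  (fun X Y f g => homotopic f g) (fun X => chain_id X)
  (fun X Y Z g f => chain_comp g f) _ _ _ _ _ _ _).
- move=> X Y f; exists (fun i j => linhom_zero (X i) (Y j)) => i x /=.
  by rewrite raddf0 addr0 subrr.
- move=> X Y f g [s hs]; exists (fun i j => linhom_opp (s i j)) => i x /=.
  by rewrite raddfN -opprD -hs opprB.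
- move=> X Y f g h [s hs] [t ht].
  exists (fun i j => linhom_add (s i j) (t i j)) => i x /=.
  by rewrite raddfD addrACA -hs -ht addrA subrK.
- move=> X Y Z f f' g g' [s hs] [t ht].
  exists (fun i j => linhom_add (lin_comp (s i j) (g i))
                                (lin_comp (f' j) (t i j))) => i x /=.
  rewrite linearD -[X in _ = _ + X + _]chain_mapP addrACA (chain_mapP g) -hs -linearD -ht linearB.
  by rewrite addrA subrK.
- move=> X Y f; exists (fun i j => linhom_zero (X i) (Y j)) => i x /=.
  by rewrite raddf0 addr0 subrr.
- move=> X Y f; exists (fun i j => linhom_zero (X i) (Y j)) => i x /=.
  by rewrite raddf0 addr0 subrr.
- move=> X Y Z W f g h.
  exists (fun i j => linhom_zero (X i) (W j)) => i x /=.
  by rewrite raddf0 addr0 subrr.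
Defined.

Definition totally_acyclic (E : KPro) :=
  exact_complex (underlying E) /\
  forall Q : lmodType A, projective Q -> exact_complex (homcx E Q).

Definition EPro : category := full_subcategory totally_acyclic.

Definition e_incl : functor EPro KPro := inclusion totally_acyclic.

(* A functor sending each module to a projective resolution of it; the
   augmentations res M -> M are part of the data and are natural, i.e. [res]
   lifts each linear map to a chain map of resolutions. *)
Record resolution_functor := ResolutionFunctor {
  res_functor :> functor (Mod A) KPro;
  res_aug : forall M : Mod A, {linear (res_functor M : KPro) 0 -> M};
  res_nonpos : forall (M : Mod A) (i : int), (0 < i)%R ->
    forall x : (res_functor M : KPro) i, x = 0;
  res_aug_surj : forall (M : Mod A) (m : M), exists x, res_aug M x = m;
  res_exact0 : forall (M : Mod A) (x : (res_functor M : KPro) 0),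
    res_aug M x = 0 <->
    exists y : (res_functor M : KPro) (-1), cd (res_functor M : KPro) (-1) 0 y = x;
  res_exact : forall (M : Mod A) (i : int), (i < 0)%R ->
    forall x : (res_functor M : KPro) i,
    cd (res_functor M : KPro) i (i + 1) x = 0 ->
    exists y : (res_functor M : KPro) (i - 1),
      cd (res_functor M : KPro) (i - 1) i y = x;
  res_aug_natural : forall (M M' : Mod A) (f : {linear M -> M'}) x,
    res_aug M' ((fmap res_functor (f : hom M M') : chain_map _ _) 0 x)
      = f (res_aug M x)
}.

End HomotopyCategory.

Section TateExt.
Variables (A : pzRingType) (eR : functor (KPro A) (EPro A)).
Variable res : resolution_functor A.

(* e^! res M as a complex, and e^! res f as a chain map. *)
Definition tate_cx (M : lmodType A) : complex A := sval (eR (res M)).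

Definition tate_cx_map (M M' : lmodType A) (f : {linear M -> M'}) :
    chain_map (tate_cx M) (tate_cx M') :=
  fmap eR (fmap res (f : @hom (Mod A) M M')).

Definition tate_ext (i : int) (M N : lmodType A) : zmodType :=
  cohomology (homcx (tate_cx M) N) i.

Definition tate_extl (i : int) (M M' : lmodType A) (f : {linear M -> M'})
    (N : lmodType A) : {additive tate_ext i M' N -> tate_ext i M N} :=
  cohomology_map (homcx_mapl (tate_cx_map f) N) (i := i).

Definition tate_extr (i : int) (M N N' : lmodType A) (u : {linear N -> N'}) :
    {additive tate_ext i M N -> tate_ext i M N'} :=
  cohomology_map (homcx_mapr (tate_cx M) u) (i := i).

End TateExt.

Arguments tate_ext {A} eR res i M N.
Arguments tate_extl {A} eR res i {M M'} f N.
Arguments tate_extr {A} eR res i M {N N'} u.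

Definition exact_at (U V W : zmodType) (f : U -> V) (g : V -> W) :=
  forall v, g v = 0 <-> exists u, f u = v.

(* Main.v *)
(* A short exact sequence of modules gives a triangle res M' -> res M -> res M''
   -> Sigma (res M') in K(Pro A): the cone of res M' -> res M is a projective
   resolution of M'', so the comparison theorem identifies it with res M''. A
   right adjoint preserves cone triangles: by the five lemma the cone of
   e^! res M' -> e^! res M has the universal property of e^! res M''. Applying
   Hom(-, N) gives the first sequence. The connecting map is induced by
   u : e^! res M'' -> Sigma (e^! res M'), the unique lift of
   res M'' -> Sigma (res M') along the counit; this uniqueness makes the
   connecting map natural although cones are not functorial. The second sequence
   is the snake lemma for Hom(e^! res M, -), which is exact because e^! res M
   consists of projectives. *)
Require Import Defs.
From HB Require Import structures.
From mathcomp Require Import all_boot all_order all_algebra.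
From mathcomp Require Import boolp ring_quotient zify.

Set Implicit Arguments.
Unset Strict Implicit.
Unset Printing Implicit Defensive.

Import GRing.Theory.
Local Open Scope ring_scope.

(** [eR] is only a functor on homotopy classes, with no given compatibility with shifts, cones or
    addition. What is extracted from the adjunction is the naturality of the counit and its
    universal property against totally acyclic complexes, [coreflection]. That property makes sense
    for any chain map, and since E(A) is closed under shifts and cones, it passes from two counits
    to the map between their cones. This yields the triangle without first proving that [eR] is
    exact. Lifts and comparison maps are unique only up to homotopy, and maps of cones not even
    that. The boundary maps are therefore described by predicates, [res_boundary] and
    [tate_boundary], and naturality is proved for all maps that satisfy them, so that choosing one
    afterwards is harmless. A second obstacle is that degrees such as [- i + 1] and [- (i - 1)] are
    equal only propositionally. Statements either quantify over degrees linked by equations or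
    insert [deg_cast], which is zero between different degrees. *)

Section LinearOf.
Variables (A : pzRingType) (U V : lmodType A) (f : U -> V) (lf : linear f).

(** The proof of linearity is an argument so that the structure instance attached to this constant
    can recover it. *)
Definition linear_fun of linear f := f.
HB.instance Definition _ :=
  GRing.isLinear.Build A U V ( *:%R) (linear_fun lf) lf.

Definition linear_of : {linear U -> V} := linear_fun lf.

End LinearOf.

Arguments linear_fun {A U V} f lf /.

(** * Lifting through projectives *)

Section ProjectiveLift.
Variables (A : pzRingType) (U V : lmodType A) (g : {linear U -> V}).

Definition image_pred : {pred V} := fun v => `[< exists u, g u = v >].

Fact image_pred_submod : submod_closed image_pred.
Proof.
split=> [|a x y]; rewrite !unfold_in.
  by apply/asboolP; exists 0; rewrite raddf0.
move=> /asboolP[u <-] /asboolP[v <-]; apply/asboolP; exists (a *: u + v).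
by rewrite linearP.
Qed.
HB.instance Definition _ :=
  GRing.isSubmodClosed.Build A V image_pred image_pred_submod.

Record image_module := ImageModule {
  image_val :> V;
  image_valP : image_val \in image_pred
}.
HB.instance Definition _ := [isSub for image_val].
HB.instance Definition _ := [Choice of image_module by <:].
HB.instance Definition _ := [SubChoice_isSubLmodule of image_module by <:].

(** Projectivity lifts along surjections only, so both maps are corestricted to the image of [g],
    which is made into a module for this purpose. *)
Lemma projective_lift_image (P : lmodType A) (f : {linear P -> V}) :
  projective P -> (forall x, exists u, g u = f x) ->
  exists h : {linear P -> U}, forall x, g (h x) = f x.
Proof.
move=> Pproj fim.
have gP u : g u \in image_pred by apply/asboolP; exists u.
have fP x : f x \in image_pred by apply/asboolP; apply: fim.
have lg : linear (fun u => ImageModule (gP u)).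
  by move=> a x y; apply: val_inj; rewrite /= linearP.
have lf : linear (fun u => ImageModule (fP u)).
  by move=> a x y; apply: val_inj; rewrite /= linearP.
case: (Pproj _ _ (linear_of lg) (linear_of lf)) => [v|h hE].
  have /asboolP[u gu] := image_valP v; exists u; exact: val_inj.
by exists h => x; have /(congr1 val) := hE x.
Qed.

End ProjectiveLift.

(** * Chain maps up to homotopy *)

Section DegreeCast.
Variables (A : pzRingType) (X : complex A).

(* Moves elements between propositionally equal degrees without transports. *)
Definition deg_cast (i j : int) : {linear X i -> X j} :=
  match i =P j with
  | ReflectT e => eq_rect i (fun k => {linear X i -> X k}) (lin_id (X i)) j e
  | ReflectF _ => linhom_zero (X i) (X j)
  end.

Lemma deg_cast_id i x : deg_cast i i x = x.
Proof. by rewrite /deg_cast; case: eqP => // e; rewrite (eq_irrelevance e erefl). Qed.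

Lemma deg_cast_out i j x : i != j -> deg_cast i j x = 0.
Proof. by rewrite /deg_cast; case: eqP. Qed.

Lemma deg_cast_trans i j k x :
  i = j -> deg_cast j k (deg_cast i j x) = deg_cast i k x.
Proof. by move=> e; subst; rewrite deg_cast_id. Qed.

Lemma deg_castK i j x : i = j -> deg_cast j i (deg_cast i j x) = x.
Proof. by move=> e; rewrite deg_cast_trans // deg_cast_id. Qed.

Lemma cd_deg_cast i j k x : i = j -> cd X j k (deg_cast i j x) = cd X i k x.
Proof. by move=> e; subst; rewrite deg_cast_id. Qed.

Lemma deg_cast_cd i j k x : j = k -> deg_cast j k (cd X i j x) = cd X i k x.
Proof. by move=> e; subst; rewrite deg_cast_id. Qed.

End DegreeCast.

Lemma chain_deg_cast (A : pzRingType) (X Y : complex A) (f : chain_map X Y) i j x :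
  f j (deg_cast X i j x) = deg_cast Y i j (f i x).
Proof.
have [<-|ne] := eqVneq i j; first by rewrite !deg_cast_id.
by rewrite !deg_cast_out // raddf0.
Qed.

Definition chain_map_of_succ (A : pzRingType) (X Y : complex A)
    (f : forall i, {linear X i -> Y i})
    (fP : forall i x, f (i + 1) (cd X i (i + 1) x) = cd Y i (i + 1) (f i x)) :
  chain_map X Y.
Proof.
exists f => i j x; have [->|ne] := eqVneq j (i + 1); first exact: fP.
by rewrite !(cd_shape ne) raddf0.
Defined.

Section ChainMapGroup.
Variables (A : pzRingType) (X Y : complex A).

Lemma chain_map_ext (f g : chain_map X Y) : (forall i, f i =1 g i) -> f = g.
Proof.
case: f g => [f Hf] [g Hg] /= e.
have efg : f = g.
  by apply: functional_extensionality_dep => i; exact: (linear_ext (e i)).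
by subst g; congr ChainMap; apply: Prop_irrelevance.
Qed.

HB.instance Definition _ := gen_eqMixin (chain_map X Y).
HB.instance Definition _ := gen_choiceMixin (chain_map X Y).

Definition chain_zero : chain_map X Y.
Proof.
exists (fun i => linhom_zero (X i) (Y i)).
by move=> i j x; rewrite /= raddf0.
Defined.

Definition chain_opp (f : chain_map X Y) : chain_map X Y.
Proof.
exists (fun i => linhom_opp (f i)).
by move=> i j x; rewrite /= chain_mapP raddfN.
Defined.

Definition chain_add (f g : chain_map X Y) : chain_map X Y.
Proof.
exists (fun i => linhom_add (f i) (g i)).
by move=> i j x; rewrite /= !chain_mapP raddfD.
Defined.

Fact chain_addA : associative chain_add.
Proof. by move=> f g h; apply: chain_map_ext => i x /=; rewrite addrA. Qed.
Fact chain_addC : commutative chain_add.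
Proof. by move=> f g; apply: chain_map_ext => i x /=; rewrite addrC. Qed.
Fact chain_add0 : left_id chain_zero chain_add.
Proof. by move=> f; apply: chain_map_ext => i x /=; rewrite add0r. Qed.
Fact chain_addN : left_inverse chain_zero chain_opp chain_add.
Proof. by move=> f; apply: chain_map_ext => i x /=; rewrite addNr. Qed.
HB.instance Definition _ := GRing.isZmodule.Build (chain_map X Y)
  chain_addA chain_addC chain_add0 chain_addN.

(* The form of [homotopic] in which the degrees i - 1 and i + 1 can be replaced
   by propositionally equal ones. *)
Lemma homotopicP (f g : chain_map X Y) :
  homotopic f g <->
  exists s : forall i j, {linear X i -> Y j},
    forall i j k x, j + 1 = i -> k = i + 1 ->
      f i x - g i x = cd Y j i (s i j x) + s k i (cd X i k x).
Proof.
split=> -[s hs]; exists s.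
  by move=> i j k x ji ->; have -> : j = i - 1 by lia.
by move=> i x; apply: hs => //; lia.
Qed.

Lemma homotopic_sub0 (f g : chain_map X Y) : homotopic f g -> homotopic (f - g) 0.
Proof. by case=> s hs; exists s => i x; rewrite -hs /= subr0. Qed.

Lemma homotopic_of_sub0 (f g : chain_map X Y) : homotopic (f - g) 0 -> homotopic f g.
Proof. by case=> s hs; exists s => i x; rewrite -hs /= subr0. Qed.

Lemma homotopic_add (f g f' g' : chain_map X Y) :
  homotopic f f' -> homotopic g g' -> homotopic (f + g) (f' + g').
Proof.
move=> [s hs] [t ht]; exists (fun i j => linhom_add (s i j) (t i j)) => i x /=.
by rewrite opprD addrACA hs ht (linearD (cd Y _ _)) addrACA.
Qed.

Lemma homotopic_opp (f g : chain_map X Y) :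
  homotopic f g -> homotopic (- f) (- g).
Proof.
move=> [s hs]; exists (fun i j => linhom_opp (s i j)) => i x /=.
by rewrite (linearN (cd Y _ _)) -2!opprD hs.
Qed.

Lemma homotopic_refl (f : chain_map X Y) : homotopic f f.
Proof.
exists (fun i j => linhom_zero (X i) (Y j)) => i x /=.
by rewrite raddf0 addr0 subrr.
Qed.

Lemma homotopic_eq (f g : chain_map X Y) : f = g -> homotopic f g.
Proof. by move=> ->; exact: homotopic_refl. Qed.

Lemma homotopic_sym (f g : chain_map X Y) : homotopic f g -> homotopic g f.
Proof.
move=> /homotopic_sub0/homotopic_opp; rewrite opprB oppr0.
exact: homotopic_of_sub0.
Qed.

Lemma homotopic_trans (f g h : chain_map X Y) :
  homotopic f g -> homotopic g h -> homotopic f h.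
Proof.
move=> /homotopic_sub0 fg /homotopic_sub0 gh; apply: homotopic_of_sub0.
by have := homotopic_add fg gh; rewrite addr0 addrA subrK.
Qed.

End ChainMapGroup.

#[export] Instance homotopic_equivalence (A : pzRingType) (X Y : complex A) :
  RelationClasses.Equivalence (@homotopic A X Y).
Proof.
split; [exact: homotopic_refl|exact: homotopic_sym|exact: homotopic_trans].
Qed.

Section Composition.
Variables (A : pzRingType) (X Y Z W : complex A).

Lemma chain_compA (h : chain_map Z W) (g : chain_map Y Z) (f : chain_map X Y) :
  chain_comp h (chain_comp g f) = chain_comp (chain_comp h g) f.
Proof. exact: chain_map_ext. Qed.

Lemma chain_comp1l (f : chain_map X Y) : chain_comp (chain_id Y) f = f.
Proof. exact: chain_map_ext. Qed.

Lemma chain_comp1r (f : chain_map X Y) : chain_comp f (chain_id X) = f.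
Proof. exact: chain_map_ext. Qed.

Lemma chain_compBr (g : chain_map Y Z) (f f' : chain_map X Y) :
  chain_comp g (f - f') = chain_comp g f - chain_comp g f'.
Proof. by apply: chain_map_ext => i x /=; rewrite raddfB. Qed.

Lemma chain_compDr (g : chain_map Y Z) (f f' : chain_map X Y) :
  chain_comp g (f + f') = chain_comp g f + chain_comp g f'.
Proof. by apply: chain_map_ext => i x /=; rewrite raddfD. Qed.

Lemma chain_comp0r (g : chain_map Y Z) : chain_comp g (0 : chain_map X Y) = 0.
Proof. by apply: chain_map_ext => i x /=; rewrite raddf0. Qed.

Lemma chain_comp0l (f : chain_map X Y) : chain_comp (0 : chain_map Y Z) f = 0.
Proof. exact: chain_map_ext. Qed.

Lemma homotopic_compr (g : chain_map Y Z) (f f' : chain_map X Y) :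
  homotopic f f' -> homotopic (chain_comp g f) (chain_comp g f').
Proof.
move=> [s hs]; exists (fun i j => lin_comp (g j) (s i j)) => i x /=.
by rewrite -raddfB hs raddfD /= chain_mapP.
Qed.

Lemma homotopic_compl (g g' : chain_map Y Z) (f : chain_map X Y) :
  homotopic g g' -> homotopic (chain_comp g f) (chain_comp g' f).
Proof.
move=> [s hs]; exists (fun i j => lin_comp (s i j) (f i)) => i x /=.
by rewrite hs chain_mapP.
Qed.

End Composition.

Section Shift.
Variable A : pzRingType.

(* The differential is negated for every n, whatever its parity: only shifts by
   1 and -1 are used. *)
Definition shift (n : int) (X : complex A) : complex A.
Proof.
refine (@Complex A (fun i => X (i + n))
  (fun i j => linhom_opp (cd X (i + n) (j + n))) _ _).
- move=> i j ne x /=; rewrite cd_shape ?oppr0 //.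
  by apply: contra ne => /eqP ?; apply/eqP; lia.
- by move=> i j k x /=; rewrite linearN cdd !oppr0.
Defined.

Definition shift_map (n : int) (X Y : complex A) (f : chain_map X Y) :
  chain_map (shift n X) (shift n Y).
Proof.
refine (@ChainMap A (shift n X) (shift n Y) (fun i => f (i + n)) _).
by move=> i j x /=; rewrite (linearN (f _)) chain_mapP.
Defined.

Lemma shift_homotopic (n : int) (X Y : complex A) (f g : chain_map X Y) :
  homotopic f g -> homotopic (shift_map n f) (shift_map n g).
Proof.
move=> /homotopicP[s hs]; apply/homotopicP.
exists (fun i j => linhom_opp (s (i + n) (j + n))) => i j k x ji ki /=.
rewrite (hs _ (j + n) (k + n)); [|lia|lia].
by rewrite (linearN (cd Y _ _)) (linearN (s _ _)) !opprK.
Qed.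

Lemma shift_comp n (X Y Z : complex A) (g : chain_map Y Z) (f : chain_map X Y) :
  shift_map n (chain_comp g f) = chain_comp (shift_map n g) (shift_map n f).
Proof. exact: chain_map_ext. Qed.

Lemma shift_map0 n (X Y : complex A) : shift_map n (0 : chain_map X Y) = 0.
Proof. exact: chain_map_ext. Qed.

Section Unshift.
Variables (m n : int) (mn : m + n = 0) (X : complex A).

(** The two negations of the differential cancel, so only the degrees [i + m + n] and [i] remain to
    be identified. *)
Definition unshift : chain_map (shift m (shift n X)) X.
Proof.
refine (@ChainMap A (shift m (shift n X)) X
  (fun i => deg_cast X (i + m + n) i) _).
by move=> i j x /=; rewrite opprK deg_cast_cd ?cd_deg_cast //; lia.
Defined.

Definition reshift : chain_map X (shift m (shift n X)).
Proof.
refine (@ChainMap A X (shift m (shift n X)) (fun i => deg_cast X i (i + m + n)) _).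
by move=> i j x /=; rewrite opprK deg_cast_cd ?cd_deg_cast //; lia.
Defined.

End Unshift.

Lemma unshift_natural m n (mn : m + n = 0) (X Y : complex A) (f : chain_map X Y) :
  chain_comp f (unshift mn X) = chain_comp (unshift mn Y) (shift_map m (shift_map n f)).
Proof. by apply: chain_map_ext => i x /=; rewrite chain_deg_cast. Qed.

End Shift.

(** * Cones *)

Section Pairing.
Variables (A : pzRingType) (U V W : lmodType A).

Definition lin_fst : {linear (U * V)%type -> U} := @fst U V.
Definition lin_snd : {linear (U * V)%type -> V} := @snd U V.

Fact lin_pair_linear (f : {linear W -> U}) (g : {linear W -> V}) :
  linear (fun x => (f x, g x)).
Proof. by move=> a x y; rewrite !linearP. Qed.
Definition lin_pair f g : {linear W -> (U * V)%type} :=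
  linear_of (lin_pair_linear f g).

End Pairing.

Section Cone.
Variables (A : pzRingType) (X Y : complex A) (f : chain_map X Y).

(** The differential is (x, y) |-> (- d x, f x + d y). The cast kills the component of [f] unless j
    = i + 1, which gives the shape condition. *)
Definition cone : complex A.
Proof.
refine (@Complex A (fun i => (X (i + 1)%R * Y i)%type)
  (fun i j => lin_pair
    (linhom_opp (lin_comp (cd X (i + 1) (j + 1)) (lin_fst _ _)))
    (linhom_add
      (lin_comp (deg_cast Y (i + 1) j) (lin_comp (f (i + 1)) (lin_fst _ _)))
      (lin_comp (cd Y i j) (lin_snd _ _)))) _ _).
- move=> i j ne [x y] /=; rewrite !cd_shape ?deg_cast_out ?oppr0 ?addr0 //.
    by apply: contra ne => /eqP ?; apply/eqP; lia.
  by apply: contra ne => /eqP ?; apply/eqP; lia.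
- move=> i j k [x y] /=; congr (_, _); first by rewrite linearN cdd !oppr0.
  have [->|ne] := eqVneq j (i + 1); last first.
    rewrite (cd_shape ne) (deg_cast_out _ (i := i + 1)) 1?eq_sym //.
    rewrite cd_shape ?oppr0 ?raddf0 ?addr0 //; last first.
      by apply: contra ne => /eqP ?; apply/eqP; lia.
    by rewrite !raddf0 addr0.
  rewrite deg_cast_id !linearN linearD cdd addr0 -chain_deg_cast.
  have [->|ne] := eqVneq k (i + 1 + 1); last first.
    by rewrite deg_cast_out ?raddf0 ?oppr0 ?add0r 1?eq_sym // cd_shape.
  by rewrite deg_cast_id chain_mapP addNr.
Defined.

Lemma cone_cdE i j (z : cone i) :
  cd cone i j z = (- cd X (i + 1) (j + 1) z.1,
                   deg_cast Y (i + 1) j (f (i + 1) z.1) + cd Y i j z.2).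
Proof. by []. Qed.

Definition cone_inj : chain_map Y cone.
Proof.
refine (@ChainMap A Y cone (fun i => lin_pair (linhom_zero _ _) (lin_id _)) _).
by move=> i j x; rewrite /= !raddf0 add0r.
Defined.

Definition cone_proj : chain_map cone (shift 1 X).
Proof. by refine (@ChainMap A cone (shift 1 X) (fun i => lin_fst _ _) _). Defined.

(** The homotopy is the inclusion x |-> (x, 0) of the first summand. *)
Lemma cone_inj_null : homotopic (chain_comp cone_inj f) 0.
Proof.
apply/homotopicP; exists (fun i j => lin_pair (deg_cast X i (j + 1)) (linhom_zero _ _)).
move=> i j k x ji ki; rewrite /= subr0 /=; congr (_, _).
  by rewrite cd_deg_cast ?deg_cast_cd ?addNr //; lia.
by rewrite chain_deg_cast !deg_castK ?raddf0 ?addr0 //; lia.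
Qed.

(** The homotopy is the projection (x, y) |-> y; the term d y cancels because the shift negates the
    differential. *)
Lemma shift_cone_proj_null : homotopic (chain_comp (shift_map 1 f) cone_proj) 0.
Proof.
apply/homotopicP.
exists (fun i j => lin_comp (deg_cast Y i (j + 1)) (lin_snd _ _)).
move=> i j k [x y] ji ki /=.
rewrite subr0 cd_deg_cast ?linearD /= ?deg_castK ?deg_cast_cd; try lia.
by rewrite addrCA addNr addr0.
Qed.

End Cone.

Section ConeExactness.
Variables (A : pzRingType) (F X Y : complex A) (f : chain_map X Y).

(** The homotopy (s, 0) removes the first component of [g] and changes the second one to g_2 - f s,
    which is the required map to [Y]. *)
Lemma cone_exact_mid (g : chain_map F (cone f)) :
  homotopic (chain_comp (cone_proj f) g) 0 ->
  exists q, homotopic g (chain_comp (cone_inj f) q).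
Proof.
move=> /homotopicP[s hs].
have castE i j k x : j + 1 = i ->
    deg_cast Y (i - 1 + 1) k (f (i - 1 + 1) (s i (i - 1) x)) =
    deg_cast Y (j + 1) k (f (j + 1) (s i j x)).
  by move=> ji; have -> : i - 1 = j by lia.
pose q i : {linear F i -> Y i} := linhom_add (lin_comp (lin_snd _ _) (g i)) (linhom_opp
    (lin_comp (deg_cast Y (i - 1 + 1) i) (lin_comp (f (i - 1 + 1)) (s i (i - 1))))).
have qP i x : q (i + 1) (cd F i (i + 1) x) = cd Y i (i + 1) (q i x).
  rewrite /q /= (castE (i + 1) i) // deg_cast_id.
  rewrite chain_mapP cone_cdE /= deg_cast_id.
  have := hs i (i - 1) (i + 1) x; rewrite /= subr0 => -> //; last by lia.
  rewrite !linearD !linearN /= cd_deg_cast; last by lia.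
  by rewrite -chain_mapP addrAC addrK addrC.
exists (chain_map_of_succ qP).
apply/homotopicP; exists (fun i j => lin_pair (s i j) (linhom_zero _ _)).
move=> i j k x ji ki; have := hs i j k x ji ki; rewrite /= subr0 => gE.
rewrite raddf0 addr0 (castE i j) //; case: (g i x) gE => [a b] /= ->.
by congr (_, _) => /=; rewrite ?oppr0 ?addr0 // opprB addrC subrK.
Qed.

(** A null homotopy t of f u is exactly the second component that makes (u, t) a chain map. The lift
    is therefore strict. *)
Lemma cone_exact_proj (u : chain_map F (shift 1 X)) :
  homotopic (chain_comp (shift_map 1 f) u) 0 ->
  exists v : chain_map F (cone f), chain_comp (cone_proj f) v = u.
Proof.
move=> /homotopicP[t ht].
have castE k i (x : F k) : k = i + 1 ->
    deg_cast Y (k - 1 + 1) k (t k (k - 1) x) = deg_cast Y (i + 1) k (t k i x).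
  by move=> e; have -> : k - 1 = i by lia.
pose v i : {linear F i -> cone f i} :=
  lin_pair (u i) (lin_comp (deg_cast Y (i - 1 + 1) i) (t i (i - 1))).
have vP i x : v (i + 1) (cd F i (i + 1) x) = cd (cone f) i (i + 1) (v i x).
  rewrite cone_cdE /v /= chain_mapP; congr (_, _).
  rewrite (castE _ i) // !deg_cast_id cd_deg_cast; last by lia.
  have := ht i (i - 1) (i + 1) x; rewrite /= subr0 => -> //; last by lia.
  by rewrite addrAC addNr add0r.
exists (chain_map_of_succ vP).
exact: chain_map_ext.
Qed.

(** The first component of the null homotopy is itself a chain map [F] -> [X], and the second is a
    homotopy from [q] to its composite with [f]. *)
Lemma cone_exact_inj (q : chain_map F Y) :
  homotopic (chain_comp (cone_inj f) q) 0 ->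
  exists t, homotopic q (chain_comp f t).
Proof.
move=> /homotopicP[s hs].
have castE k i (x : F k) : k = i + 1 ->
    deg_cast X (k - 1 + 1) k (s k (k - 1) x).1 = deg_cast X (i + 1) k (s k i x).1.
  by move=> e; have -> : k - 1 = i by lia.
pose t i := lin_comp (deg_cast X (i - 1 + 1) i)
  (lin_comp (lin_fst _ _) (s i (i - 1))).
have tP i x : t (i + 1) (cd F i (i + 1) x) = cd X i (i + 1) (t i x).
  rewrite /t /= (castE _ i) // deg_cast_id cd_deg_cast; last by lia.
  have := hs i (i - 1) (i + 1) x; rewrite /= subr0 => /(_ _ erefl)/(congr1 fst) /=.
  by move/(_ ltac:(lia))/eqP; rewrite eq_sym addr_eq0 eqr_opp => /eqP <-.
exists (chain_map_of_succ tP); apply/homotopicP.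
exists (fun i j => lin_comp (lin_snd _ _) (s i j)) => i j k x ji ki.
have := hs i j k x ji ki; rewrite /= subr0 => /(congr1 snd) /= ->.
rewrite (castE _ j) -?chain_deg_cast; last by lia.
by rewrite addrAC [_ + cd _ _ _ _ - _]addrAC subrr add0r.
Qed.

End ConeExactness.

Section ConeMap.
Variables (A : pzRingType) (X Y X' Y' : complex A).
Variables (f : chain_map X Y) (f' : chain_map X' Y').
Variables (a : chain_map X X') (b : chain_map Y Y').

(* A homotopy making the square commute is turned into a strict map of cones. *)
Lemma cone_map_exists :
  homotopic (chain_comp b f) (chain_comp f' a) ->
  exists k : chain_map (cone f) (cone f'),
    [/\ chain_comp k (cone_inj f) = chain_comp (cone_inj f') b,
        chain_comp (cone_proj f') k = chain_comp (shift_map 1 a) (cone_proj f)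
      & forall i z, (forall x : X (i + 1), x = 0) -> (k i z).2 = b i z.2].
Proof.
move=> /homotopicP[s hs].
pose k i : {linear cone f i -> cone f' i} := lin_pair (lin_comp (a (i + 1)) (lin_fst _ _))
  (linhom_add (lin_comp (b i) (lin_snd _ _))
    (lin_comp (s (i + 1) i) (lin_fst (X (i + 1)) (Y i)))).
have kP i z : k (i + 1) (cd (cone f) i (i + 1) z) = cd (cone f') i (i + 1) (k i z).
  rewrite !cone_cdE /k /= !deg_cast_id; congr (_, _).
    by rewrite linearN chain_mapP.
  have := hs (i + 1) i (i + 1 + 1) z.1 erefl erefl; rewrite /= => /eqP.
  rewrite subr_eq => /eqP e; rewrite !linearD linearN e chain_mapP.
  move: (cd Y' _ _ _) (s (i + 1 + 1) _ _) (f' _ _) (cd Y' _ _ _) => d t g c.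
  by rewrite [c + t]addrC -!addrA addrC -!addrA addNr addr0 addrC -addrA.
exists (chain_map_of_succ kP); split.
- by apply: chain_map_ext => i x /=; rewrite !raddf0 addr0.
- exact: chain_map_ext.
- by move=> i z X0 /=; rewrite (X0 z.1) raddf0 addr0.
Qed.

End ConeMap.

(** * Totally acyclic complexes and coreflections *)

Section TotallyAcyclic.
Variable A : pzRingType.

Lemma exact_underlyingP (X : complex A) :
  exact_complex (underlying X) <->
  forall i j k (x : X j), i + 1 = j -> k = j + 1 -> cd X j k x = 0 ->
    exists y : X i, cd X i j y = x.
Proof.
split=> H.
  move=> i j k x ij jk; have -> : i = j - 1 by lia.
  by rewrite jk; exact: H.
by move=> i x dx; apply: (H (i - 1) i (i + 1)) => //; lia.
Qed.

(** Trades the negated degrees of [homcx] for degrees of [X] linked by equations, so that shifts and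
    cones can be treated without casts. *)
Lemma exact_homcxP (X : complex A) (N : lmodType A) :
  exact_complex (homcx X N) <->
  forall i j k (g : {linear X j -> N}), i + 1 = j -> k = j + 1 ->
    (forall x, g (cd X i j x) = 0) ->
    exists h : {linear X k -> N}, forall x, h (cd X j k x) = g x.
Proof.
split=> H.
  move=> i j k; have [m ->] : exists m, j = - m by exists (- j); rewrite opprK.
  move=> g ij jk gd; have im : i = - (m + 1) by lia.
  have km : k = - (m - 1) by lia.
  clear ij jk; subst i k; have [|h hE] := H m g.
    by apply: linear_ext => x; exact: gd.
  exists h => x; exact: (congr1 (fun u : linhom _ _ => u x) hE).
move=> m g gd; have [||x|h hE] := H (- (m + 1)) (- m) (- (m - 1)) g; try lia.
  by move/(congr1 (fun u : linhom _ _ => u x)): gd.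
by exists h; apply: linear_ext => x; rewrite -hE.
Qed.

Lemma projective_prod (P Q : lmodType A) :
  projective P -> projective Q -> projective (P * Q)%type.
Proof.
move=> projP projQ U V g f gsurj.
have [h1 h1E] := projP _ _ g (lin_comp f (lin_pair (lin_id _) (linhom_zero _ _))) gsurj.
have [h2 h2E] := projQ _ _ g (lin_comp f (lin_pair (linhom_zero _ _) (lin_id _))) gsurj.
exists (linhom_add (lin_comp h1 (lin_fst _ _)) (lin_comp h2 (lin_snd _ _))).
case=> x y; rewrite /= linearD h1E h2E /= -linearD; congr (f _).
by congr (_, _); rewrite ?addr0 ?add0r.
Qed.

Definition shift_pro (n : int) (X : procomplex A) : procomplex A :=
  @ProComplex A (shift n X) (fun i => @pro_projective A X (i + n)).

Definition cone_pro (X Y : procomplex A) (f : chain_map X Y) : procomplex A :=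
  @ProComplex A (cone f)
    (fun i => projective_prod (@pro_projective A X (i + 1)) (@pro_projective A Y i)).

Lemma shift_totally_acyclic n (X : procomplex A) :
  totally_acyclic (X : KPro A) -> totally_acyclic (shift_pro n X : KPro A).
Proof.
case=> /exact_underlyingP ex exQ; split.
  apply/exact_underlyingP => i j k x ij jk /= /eqP; rewrite oppr_eq0 => /eqP dx.
  have [||y yE] := ex (i + n) (j + n) (k + n) x _ _ dx; try lia.
  by exists (- y); rewrite /= linearN opprK.
move=> Q projQ; have /exact_homcxP exX := exQ Q projQ.
apply/exact_homcxP => i j k g ij jk gd.
have [|||h hE] := exX (i + n) (j + n) (k + n) g; try lia.
  by move=> x; apply: oppr_inj; rewrite oppr0 -linearN; exact: gd.
by exists (linhom_opp h) => x /=; rewrite linearN opprK hE.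
Qed.

(** The cone is a degreewise split extension of the shift of [X] by [Y]. For a cocycle (x, y), write
    x = d a and y + f a = d b; then (- a, b) is a preimage. Dually, a functional is first extended
    over its part on [Y], and the remainder g1 - h2 f is then a cocycle on [X]. *)
Lemma cone_totally_acyclic (X Y : procomplex A) (f : chain_map X Y) :
  totally_acyclic (X : KPro A) -> totally_acyclic (Y : KPro A) ->
  totally_acyclic (cone_pro f : KPro A).
Proof.
move=> [/exact_underlyingP exX exQX] [/exact_underlyingP exY exQY]; split.
  apply/exact_underlyingP => i j k [x y] ij jk; subst j k => /= -[] /eqP.
  rewrite oppr_eq0 deg_cast_id => /eqP dx dy.
  have [a aE] := exX (i + 1) (i + 1 + 1) (i + 1 + 1 + 1) x erefl erefl dx.
  have [|b bE] := exY i (i + 1) (i + 1 + 1) (y + f (i + 1) a) erefl erefl.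
    by rewrite linearD -chain_mapP aE [LHS]addrC.
  exists (- a, b); rewrite /= deg_cast_id !linearN opprK aE bE.
  by rewrite [_ + (y + _)]addrC addrK.
move=> Q projQ; have /exact_homcxP hX := exQX Q projQ.
have /exact_homcxP hY := exQY Q projQ.
apply/exact_homcxP => i j k g ij jk; subst j k => gd.
pose g1 := lin_comp g (lin_pair (lin_id _) (linhom_zero _ (Y (i + 1)))).
pose g2 := lin_comp g (lin_pair (linhom_zero _ (X (i + 1 + 1))) (lin_id _)).
have gE x y : g (x, y) = g1 x + g2 y.
  rewrite -[RHS]/(g (x, 0) + g (0, y)) -linearD; congr (g _).
  by congr (_, _); rewrite /= ?addr0 ?add0r.
have [|h2 h2E] := hY i (i + 1) (i + 1 + 1) g2 erefl erefl.
  by move=> y; have := gd (0, y); rewrite gE /= !raddf0 !add0r.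
have [|h1 h1E] := hX (i + 1) (i + 1 + 1) (i + 1 + 1 + 1)
    (linhom_add g1 (linhom_opp (lin_comp h2 (f (i + 1 + 1))))) erefl erefl.
  move=> x; rewrite -[LHS]/(g1 _ - h2 _) chain_mapP h2E.
  have := gd (x, 0); rewrite cone_cdE gE.
  by rewrite raddf0 addr0 deg_cast_id linearN addrC => /subr0_eq ->; rewrite subrr.
exists (linhom_add (linhom_opp (lin_comp h1 (lin_fst _ _))) (lin_comp h2 (lin_snd _ _))).
case=> x y; rewrite cone_cdE gE -[LHS]/(- h1 _ + h2 _).
rewrite linearN opprK deg_cast_id linearD h2E h1E.
by rewrite -[linhom_add _ _ _]/(g1 _ - h2 _) addrA subrK.
Qed.

End TotallyAcyclic.

Section Coreflection.
Variable A : pzRingType.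

Definition EPro_cx (E : EPro A) : complex A := pro_cx (sval E).

(** Composition with [eps] is a bijection on homotopy classes of maps out of each totally acyclic
    complex; by additivity, injectivity need only be stated at 0. [E] is a bare complex, so that
    shifts and cones fit without repackaging. *)
Definition coreflection (E X : complex A) (eps : chain_map E X) :=
  (forall (F : EPro A) (g : chain_map (EPro_cx F) X),
     exists v : chain_map (EPro_cx F) E, homotopic (chain_comp eps v) g) /\
  (forall (F : EPro A) (v : chain_map (EPro_cx F) E),
     homotopic (chain_comp eps v) 0 -> homotopic v 0).

Lemma coreflection_uniq (E X : complex A) (eps : chain_map E X) (F : EPro A)
    (v v' : chain_map (EPro_cx F) E) :
  coreflection eps -> homotopic (chain_comp eps v) (chain_comp eps v') ->
  homotopic v v'.
Proof.
move=> [_ inj] /homotopic_sub0; rewrite -chain_compBr => /inj.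
exact: homotopic_of_sub0.
Qed.

Definition shiftE (n : int) (F : EPro A) : EPro A :=
  exist _ (shift_pro n (sval F) : KPro A) (shift_totally_acyclic n (proj2_sig F)).

Definition coneE (E F : EPro A) (f : chain_map (EPro_cx E) (EPro_cx F)) : EPro A :=
  exist _ (cone_pro f : KPro A) (cone_totally_acyclic f (proj2_sig E) (proj2_sig F)).

Lemma deg_cast_shift n (X : complex A) i j x :
  deg_cast (shift n X) i j x = deg_cast X (i + n) (j + n) x.
Proof.
have [<-|ne] := eqVneq i j; first by rewrite !deg_cast_id.
by rewrite !deg_cast_out //; apply: contra ne => /eqP ?; apply/eqP; lia.
Qed.

Section Transpose.
Variables (m n : int) (mn : m + n = 0) (nm : n + m = 0) (F X : complex A).

Definition shift_transpose (g : chain_map F (shift n X)) : chain_map (shift m F) X :=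
  chain_comp (unshift mn X) (shift_map m g).

Lemma shift_transposeK (g : chain_map F (shift n X)) :
  chain_comp (shift_map n (shift_transpose g)) (reshift nm F) = g.
Proof.
apply: chain_map_ext => i x /=; rewrite chain_deg_cast deg_cast_shift.
by rewrite deg_cast_trans ?deg_cast_id //; lia.
Qed.

End Transpose.

(** The shift is moved to the test object: maps from F to the shift of [X] correspond to maps from
    the opposite shift of F to [X], and E(A) is closed under shifts. *)
Lemma shift_coreflection n (E X : complex A) (eps : chain_map E X) :
  coreflection eps -> coreflection (shift_map n eps).
Proof.
move=> [surj inj]; have mn : - n + n = 0 by exact: addNr.
have nm : n + - n = 0 by exact: subrr.
split=> F g.
  have [v vE] := surj (shiftE (- n) F) (shift_transpose mn g).
  exists (chain_comp (shift_map n v) (reshift nm (EPro_cx F))).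
  rewrite chain_compA -shift_comp -[X in homotopic _ X](shift_transposeK mn nm).
  exact/homotopic_compl/shift_homotopic.
move=> epsg; rewrite -[g](shift_transposeK mn nm).
rewrite -[X in homotopic _ X](chain_comp0l _ (reshift nm (EPro_cx F))) -(shift_map0 n).
apply/homotopic_compl/shift_homotopic/(inj (shiftE (- n) F)).
rewrite /shift_transpose chain_compA unshift_natural -chain_compA -shift_comp.
rewrite -[X in homotopic _ X](chain_comp0r _ (unshift mn X)).
by apply/homotopic_compr; rewrite -(shift_map0 (- n)); exact: shift_homotopic.
Qed.

(* The five lemma for the two cone triangles. *)
Lemma cone_coreflection (E X E' X' : complex A)
    (f : chain_map X X') (fE : chain_map E E')
    (eps : chain_map E X) (eps' : chain_map E' X')
    (k : chain_map (cone fE) (cone f)) :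
  homotopic (chain_comp eps' fE) (chain_comp f eps) ->
  chain_comp k (cone_inj fE) = chain_comp (cone_inj f) eps' ->
  chain_comp (cone_proj f) k = chain_comp (shift_map 1 eps) (cone_proj fE) ->
  coreflection eps -> coreflection eps' -> coreflection k.
Proof.
move=> sq kj pk ce ce'; have cs := shift_coreflection 1 ce.
have cs' := shift_coreflection 1 ce'.
split=> F g.
  have [u uE] := cs.1 F (chain_comp (cone_proj f) g).
  have : homotopic (chain_comp (shift_map 1 fE) u) 0.
    apply: cs'.2; rewrite chain_compA -shift_comp.
    transitivity (chain_comp (shift_map 1 (chain_comp f eps)) u).
      exact/homotopic_compl/shift_homotopic.
    rewrite shift_comp -chain_compA.
    transitivity (chain_comp (chain_comp (shift_map 1 f) (cone_proj f)) g).
      by rewrite -chain_compA; exact: homotopic_compr.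
    rewrite -[X in homotopic _ X](chain_comp0l _ g).
    exact/homotopic_compl/shift_cone_proj_null.
  move=> /cone_exact_proj[v vE].
  (* [v] has the right projection only; the error [g - k v] dies under [cone_proj], so it comes from
     X', where it can be lifted through [eps']. *)
  have [q qE] : exists q, homotopic (g - chain_comp k v) (chain_comp (cone_inj f) q).
    apply: cone_exact_mid; rewrite chain_compBr chain_compA pk -chain_compA vE.
    exact/homotopic_sub0/homotopic_sym.
  have [r rE] := ce'.1 F q.
  exists (v + chain_comp (cone_inj fE) r).
  rewrite chain_compDr chain_compA kj -chain_compA.
  apply: homotopic_trans (homotopic_add (homotopic_refl _) (homotopic_compr _ rE)) _.
  apply: homotopic_trans (homotopic_add (homotopic_refl _) (homotopic_sym qE)) _.
  by apply: homotopic_eq; rewrite addrC subrK.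
move=> kg; have : homotopic (chain_comp (cone_proj fE) g) 0.
  apply: cs.2; rewrite chain_compA -pk -chain_compA.
  rewrite -[X in homotopic _ X](chain_comp0r _ (cone_proj f)).
  exact: homotopic_compr.
move=> /cone_exact_mid[w wE].
have : homotopic (chain_comp (cone_inj f) (chain_comp eps' w)) 0.
  rewrite chain_compA -kj -chain_compA.
  exact: homotopic_trans (homotopic_compr _ (homotopic_sym wE)) kg.
(* Once [w] is shown to factor through [fE] up to homotopy, [g] factors through [cone_inj fE]
   composed with [fE], which is null. *)
move=> /cone_exact_inj[t tE]; have [r rE] := ce.1 F t.
have wr : homotopic w (chain_comp fE r).
  apply: coreflection_uniq ce' _; apply: homotopic_trans tE _.
  rewrite chain_compA; apply: homotopic_trans (homotopic_compl _ (homotopic_sym sq)).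
  by rewrite -chain_compA; exact: homotopic_compr (homotopic_sym rE).
apply: homotopic_trans wE _; apply: homotopic_trans (homotopic_compr _ wr) _.
rewrite chain_compA -[X in homotopic _ X](chain_comp0l _ r).
exact/homotopic_compl/cone_inj_null.
Qed.

Section Counit.
Variables (eR : functor (KPro A) (EPro A)) (eR_adj : adjunction (e_incl A) eR).

Definition counit (X : KPro A) : chain_map (EPro_cx (eR X)) (X : procomplex A) :=
  adj_inv eR_adj (idm (eR X)).

(** Naturality of [adj] at the counit: transposition is inverse to composition with the counit. *)
Lemma adj_counit (F : EPro A) (X : KPro A) (v : Defs.hom F (eR X)) :
  heq (adj eR_adj (chain_comp (counit X) v : Defs.hom (e_incl A F) X)) v.
Proof.
apply: (@heq_trans _ _ _ _ (adj eR_adj (mcomp (idm X)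
    (mcomp (counit X : Defs.hom (e_incl A (eR X)) X) (fmap (e_incl A) v))))).
  by apply: adj_heq; apply: heq_sym; exact: comp_idl.
apply: heq_trans (adj_natural eR_adj _ _ _) _.
apply: heq_trans (comp_heq (fmap_id _ _) (comp_heq (adj_invK _ _) (heq_refl _))) _.
apply: heq_trans (comp_idl _) _; exact: comp_idl.
Qed.

Lemma adj_injective (F : EPro A) (X : KPro A) (g g' : Defs.hom (e_incl A F) X) :
  heq (adj eR_adj g) (adj eR_adj g') -> heq g g'.
Proof.
move=> e; apply: heq_trans (heq_sym (adjK eR_adj g)) _.
exact: heq_trans (adj_inv_heq _ e) (adjK eR_adj g').
Qed.

Lemma counit_coreflection (X : KPro A) : coreflection (counit X).
Proof.
split=> F g.
  exists (adj eR_adj (g : Defs.hom (e_incl A F) X)).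
  by apply: adj_injective; exact: adj_counit.
(* [adj] is not assumed additive, so 0 is written as the counit composed with 0 and both sides are
   transposed back. *)
move=> e0; have z : homotopic (chain_comp (counit X) (0 : chain_map (EPro_cx F) _)) 0.
  by rewrite chain_comp0r; exact: homotopic_refl.
have := adj_heq eR_adj (homotopic_trans e0 (homotopic_sym z) : @heq (KPro A) _ _ _ _).
by move=> h; exact: heq_trans (heq_trans (heq_sym (adj_counit _)) h) (adj_counit _).
Qed.

Lemma counit_natural (X Y : KPro A) (f : Defs.hom X Y) :
  homotopic (chain_comp (counit Y) (fmap eR f : chain_map (EPro_cx (eR X)) (EPro_cx (eR Y))))
    (chain_comp (f : chain_map _ _) (counit X)).
Proof.
apply: (@adj_injective (eR X) Y); apply: heq_trans (adj_counit _) _.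
apply: heq_sym; apply: (@heq_trans _ _ _ _ (adj eR_adj (mcomp f
    (mcomp (counit X : Defs.hom (e_incl A (eR X)) X) (fmap (e_incl A) (idm (eR X))))))).
  apply: adj_heq; apply: comp_heq (heq_refl _) _; apply: heq_sym.
  exact: (@comp_idr (KPro A) _ _ (counit X : Defs.hom (e_incl A (eR X)) X)).
apply: heq_trans (adj_natural eR_adj _ _ _) _.
apply: heq_trans (comp_heq (heq_refl _) _) (comp_idr _).
exact: heq_trans (comp_idr _) (adj_invK _ _).
Qed.

End Counit.

End Coreflection.

(** * The comparison theorem *)

(** Serves to build chain maps and homotopies one degree at a time: [good] is the invariant that
    makes the next step solvable, [R] the equation between consecutive terms. *)
Lemma dependent_sequence (T : nat -> Type) (good : forall n, T n -> Prop)
    (R : forall n, T n -> T n.+1 -> Prop) (t0 : T 0%N) :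
  good 0%N t0 ->
  (forall n t, good n t -> exists2 t', good n.+1 t' & R n t t') ->
  exists t : forall n, T n, t 0%N = t0 /\ forall n, R n (t n) (t n.+1).
Proof.
move=> g0 step.
have stepS n (t : {t : T n | good n t}) :
    {t' : {t : T n.+1 | good n.+1 t} | R n (sval t) (sval t')}.
  apply: cid; case: t => t gt; have [t' gt' Rt] := step n t gt.
  by exists (exist _ t' gt').
pose seq := fix seq n : {t : T n | good n t} :=
  if n is m.+1 then sval (stepS m (seq m)) else exist _ t0 g0.
exists (fun n => sval (seq n)); split=> // n.
by rewrite /=; case: (stepS n (seq n)).
Qed.

Section Comparison.
Variable A : pzRingType.

Definition resolution (X : complex A) (M : lmodType A) (aug : {linear X 0 -> M}) :=
  [/\ forall i, (0 < i)%R -> forall x : X i, x = 0,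
      forall m, exists x, aug x = m,
      forall x, aug x = 0 <-> exists y : X (-1), cd X (-1) 0 y = x
    & forall i j k, i + 1 = j -> k = j + 1 -> (j < 0)%R ->
      forall x : X j, cd X j k x = 0 -> exists y : X i, cd X i j y = x].

Variables (P : procomplex A) (P_nonpos : forall i, (0 < i)%R -> forall x : P i, x = 0).
Variables (Q : complex A) (N : lmodType A) (aug : {linear Q 0 -> N}).
Hypothesis resQ : resolution aug.

Lemma comparison_exists (alpha : {linear P 0 -> N}) :
  (forall x, alpha (cd P (-1) 0 x) = 0) ->
  exists g : chain_map P Q, forall x, aug (g 0 x) = alpha x.
Proof.
move=> alpha_d; have [Q_nonpos aug_surj aug_exact Q_exact] := resQ.
have [h0 h0E] := pro_projective alpha aug_surj.
pose T n := {linear P (- n%:Z) -> Q (- n%:Z)}.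
(* [t d] takes values in boundaries, hence lifts through the differential of [Q]. For n = 0 this
   comes from the augmentations, afterwards from exactness of [Q]. *)
pose good n (t : T n) := forall x : P (- n.+1%:Z),
  exists y : Q (- n.+1%:Z), cd Q _ _ y = t (cd P _ _ x).
pose R n (t : T n) (t' : T n.+1) := forall x : P (- n.+1%:Z),
  cd Q _ _ (t' x) = t (cd P (- n.+1%:Z) (- n%:Z) x).
have [||t [t0E tE]] := @dependent_sequence T good R h0.
- by move=> x; apply/aug_exact; rewrite h0E alpha_d.
- move=> n t gt.
  have [t' t'E] := projective_lift_image (f := lin_comp t (cd P (- n.+1%:Z) (- n%:Z)))
    (@pro_projective A P (- n.+1%:Z)) gt.
  exists t' => // x; apply: (Q_exact _ _ (- n%:Z)); try lia.
  by rewrite t'E /= cdd raddf0.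
(* For i <= 0 the casts are identifications; for i > 0 they vanish and [g] is zero. *)
pose g i : {linear P i -> Q i} := lin_comp (deg_cast Q (- `|i|%:Z) i)
  (lin_comp (t `|i|%N) (deg_cast P i (- `|i|%:Z))).
have gE n x : g (- n%:Z) x = t n x.
  rewrite /g /=; have -> : `|- n%:Z|%N = n by lia.
  by rewrite !deg_cast_id.
have gP i x : g (i + 1) (cd P i (i + 1) x) = cd Q i (i + 1) (g i x).
  have [i0|i0] := Num.Theory.lerP 0 i.
    by rewrite [LHS]Q_nonpos 1?[RHS]Q_nonpos //; lia.
  have [n e] : exists n : nat, i = - n.+1%:Z by exists (`|i|.-1)%N; lia.
  have : i + 1 = - n%:Z by lia.
  by move: (i + 1) => j ej; subst i j; rewrite !gE tE.
exists (chain_map_of_succ gP) => x.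
by rewrite -h0E -t0E; congr (aug _); exact: (gE 0%N).
Qed.

Lemma comparison_null (f : chain_map P Q) :
  (forall x, aug (f 0 x) = 0) -> homotopic f 0.
Proof.
move=> augf; have [Q_nonpos aug_surj aug_exact Q_exact] := resQ.
pose T n := {linear P (- n%:Z) -> Q (- n.+1%:Z)}.
pose good n (t : T n) := forall x : P (- n.+1%:Z),
  exists y : Q (- n.+2%:Z), cd Q _ _ y = f _ x - t (cd P _ _ x).
pose R n (t : T n) (t' : T n.+1) := forall x : P (- n.+1%:Z),
  cd Q (- n.+2%:Z) (- n.+1%:Z) (t' x) = f _ x - t (cd P (- n.+1%:Z) (- n%:Z) x).
have [t0 t0E] := projective_lift_image (f := f 0) (@pro_projective A P 0)
  (fun x => (aug_exact _).1 (augf x)).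
have [||t [t0' tE]] := @dependent_sequence T good R t0.
- move=> x; apply: (Q_exact _ _ 0) => //.
  by rewrite linearB t0E chain_mapP subrr.
- move=> n t gt.
  have [t' t'E] := projective_lift_image
    (f := linhom_add (f _) (linhom_opp (lin_comp t (cd P (- n.+1%:Z) (- n%:Z)))))
    (@pro_projective A P (- n.+1%:Z)) gt.
  exists t' => // x; apply: (Q_exact _ _ (- n.+1%:Z)); try lia.
  rewrite linearB t'E. rewrite /= cdd raddf0. by rewrite subr0 chain_mapP subrr.
pose s i j : {linear P i -> Q j} := lin_comp (deg_cast Q (- `|i|.+1%:Z) j)
  (lin_comp (t `|i|%N) (deg_cast P i (- `|i|%:Z))).
have sE n x : s (- n%:Z) (- n.+1%:Z) x = t n x.
  rewrite /s /=; have -> : `|- n%:Z|%N = n by lia.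
  by rewrite !deg_cast_id.
apply/homotopicP; exists s => i j k x ji ki; rewrite subr0.
have [i0|i0] := Num.Theory.ltrP 0 i; first by rewrite (P_nonpos i0 x) !raddf0 addr0.
have [n e] : exists n : nat, i = - n%:Z by exists (`|i|)%N; lia.
have ej : j = - n.+1%:Z by lia.
(* In degree 0 the differential into degree 1 is zero, and the equation is the choice of [t0]. *)
clear ji; subst i j; rewrite sE; case: n => [|n] in x i0 ki *.
  have k0 : (0 < k)%R by lia.
  have -> : cd P (- 0%:Z) k x = 0 by exact: P_nonpos.
  by rewrite linear0 addr0 t0'; apply/esym/t0E.
have ek : k = - n%:Z by lia.
by clear ki; subst k; rewrite sE tE subrK.
Qed.

Lemma comparison_uniq (f g : chain_map P Q) :
  (forall x, aug (f 0 x) = aug (g 0 x)) -> homotopic f g.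
Proof.
move=> e; apply/homotopic_of_sub0/comparison_null => x.
by rewrite -[LHS]/(aug (f 0 x - g 0 x)) linearB e subrr.
Qed.

End Comparison.

Section ConeResolution.
Variables (A : pzRingType) (S : ses A) (X' X : complex A).
Variables (aug' : {linear X' 0 -> ses_sub S}) (aug : {linear X 0 -> ses_mid S}).
Variable f : chain_map X' X.
Hypothesis augf : forall x, aug (f 0 x) = ses_inj S (aug' x).

Definition cone_aug : {linear cone f 0 -> ses_quo S} :=
  lin_comp (ses_proj S) (lin_comp aug (lin_snd _ _)).

(** Degree 0 of the cone is X'^1 + X^0 with X'^1 = 0, hence [cone_aug] reads the second component
    only. Exactness at 0 uses that [aug'] is surjective, exactness at -1 that [ses_inj] is
    injective; below that it is the exactness of a cone of exact complexes. *)
Lemma cone_resolution :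
  resolution aug' -> resolution aug -> resolution cone_aug.
Proof.
move=> [np' surj' ex0' ex'] [np surj ex0 ex]; split.
- move=> i i0 [x y]; congr (_, _); first by apply: np'; lia.
  exact: np.
- move=> m; have [n <-] := ses_proj_surj m; have [x <-] := surj n.
  by exists (0, x).
- case=> x y; split.
    rewrite [x]np' //= => /ses_exact[m mE]; have [a aE] := surj' m.
    have [b bE] : exists b : X (-1), cd X (-1) 0 b = y - f 0 a.
      by apply/ex0; rewrite linearB augf aE mE subrr.
    exists (deg_cast X' 0 (- 1 + 1) a, b); congr (_, _).
      exact: np'.
    by rewrite /= chain_deg_cast deg_castK // bE addrC subrK.
  case=> -[a b] [_ <-] /=; rewrite linearD -chain_deg_cast augf linearD /=.
  have -> : aug (cd X (-1) 0 b) = 0 by apply/ex0; exists b.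
  by rewrite linear0 addr0; apply/ses_exact; eexists.
- move=> i j k ij jk j0; subst j k => -[x y] /= [] /eqP.
  rewrite oppr_eq0 deg_cast_id => /eqP dx dy.
  have [a aE] : exists a : X' (i + 1), cd X' (i + 1) (i + 1 + 1) a = x.
    (* In the remaining case x lies in X'^0, and it is a boundary once [aug'] kills it; this is
       checked after [ses_inj], where f x = d (- y). *)
    have [i1|i1] := Num.Theory.ltrP (i + 1 + 1) 0; first exact: ex' dx.
    have e : i + 1 = -1 by lia.
    move: x y dx dy j0 i1; rewrite e => x y dx dy _ _.
    apply/ex0'/(@ses_inj_inj _ S); rewrite linear0 -augf.
    apply/ex0; exists (- y); rewrite linearN.
    by apply/eqP; rewrite eq_sym -addr_eq0; apply/eqP.
  have [||||b bE] := ex i (i + 1) (i + 1 + 1) _ _ _ (y + f (i + 1) a) => //.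
    by rewrite linearD -chain_mapP aE [LHS]addrC.
  exists (- a, b); rewrite /= deg_cast_id !linearN opprK aE bE.
  by rewrite [_ + (y + _)]addrC addrK.
Qed.

End ConeResolution.

(** * The triangle of a short exact sequence *)

Section Triangles.
Variable A : pzRingType.

(** An equivalence of X'' with the cone, compatible with [p] and [w]. It is only required to exist,
    because it is not canonical. *)
Definition triangle (X' X X'' : complex A) (f : chain_map X' X)
    (p : chain_map X X'') (w : chain_map X'' (shift 1 X')) :=
  exists (k : chain_map X'' (cone f)) (l : chain_map (cone f) X''),
    [/\ homotopic (chain_comp l k) (chain_id X''),
        homotopic (chain_comp k l) (chain_id (cone f)),
        homotopic (chain_comp k p) (cone_inj f)
      & homotopic (chain_comp (cone_proj f) k) w].

Variables (eR : functor (KPro A) (EPro A)) (eR_adj : adjunction (e_incl A) eR).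
Variable res : resolution_functor A.

Definition res_cx (M : lmodType A) : procomplex A := res M.

Definition res_map (M M' : lmodType A) (f : {linear M -> M'}) :
    chain_map (res_cx M) (res_cx M') :=
  fmap res (f : @Defs.hom (Mod A) M M').

Definition res_eps (M : lmodType A) : {linear res_cx M 0 -> M} := res_aug res M.

Lemma res_epsP (M : lmodType A) : resolution (res_eps M).
Proof.
split.
- exact: (@res_nonpos _ res M).
- exact: (@res_aug_surj _ res M).
- exact: (@res_exact0 _ res M).
- move=> i j k ij -> j0 x; have -> : i = j - 1 by lia.
  exact: (@res_exact _ res M).
Qed.

Lemma res_eps_natural (M M' : lmodType A) (f : {linear M -> M'}) x :
  res_eps M' (res_map f 0 x) = f (res_eps M x).
Proof. exact: res_aug_natural. Qed.

(** The condition on augmentations determines [k] up to homotopy, by the comparison theorem, since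
    the cone is a resolution of the quotient. *)
Definition res_boundary (S : ses A)
    (w : chain_map (res_cx (ses_quo S)) (shift 1 (res_cx (ses_sub S)))) :=
  exists2 k : chain_map (res_cx (ses_quo S)) (cone (res_map (ses_inj S))),
    forall x, cone_aug (res_eps (ses_mid S)) _ (k 0 x) = res_eps _ x
    & w = chain_comp (cone_proj _) k.

Lemma res_cone_resolution (S : ses A) :
  resolution (cone_aug (res_eps (ses_mid S)) (res_map (ses_inj S))).
Proof.
exact: cone_resolution (res_eps_natural _) (res_epsP _) (res_epsP _).
Qed.

Lemma res_cx_nonpos M i : (0 < i)%R -> forall x : res_cx M i, x = 0.
Proof. by case: (res_epsP M) => np _ _ _; exact: np. Qed.

Lemma res_cone_nonpos (S : ses A) i :
  (0 < i)%R -> forall x : cone (res_map (ses_inj S)) i, x = 0.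
Proof. by case: (res_cone_resolution S) => np _ _ _; exact: np. Qed.

Lemma res_triangle (S : ses A) : exists2 w, res_boundary w &
  triangle (res_map (ses_inj S)) (res_map (ses_proj S)) w.
Proof.
pose C := cone_pro (res_map (ses_inj S)).
pose augC := cone_aug (res_eps (ses_mid S)) (res_map (ses_inj S)).
have augC_d x : augC (cd C (-1) 0 x) = 0.
  by case: (res_cone_resolution S) => _ _ ex _; apply/ex; exists x.
have aug_d x : res_eps (ses_quo S) (cd (res_cx _) (-1) 0 x) = 0.
  by case: (res_epsP (ses_quo S)) => _ _ ex _; apply/ex; exists x.
have [k kE] := comparison_exists (res_cone_resolution S) aug_d.
have [l lE] := @comparison_exists _ C _ _ _ (res_epsP (ses_quo S)) augC augC_d.
exists (chain_comp (cone_proj _) k); first by exists k.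
exists k, l; split.
- apply: comparison_uniq (@res_cx_nonpos _) _ _ _ (res_epsP _) _ _ _ => x.
  by rewrite /= lE kE.
- apply: (comparison_uniq (P := C) (@res_cone_nonpos S) (res_cone_resolution S)) => x.
  by rewrite [LHS]kE lE.
- apply: comparison_uniq (@res_cx_nonpos _) _ _ _ (res_cone_resolution S) _ _ _ => x.
  by rewrite [LHS]kE res_eps_natural.
- exact: homotopic_refl.
Qed.

Lemma res_square (M N M' N' : lmodType A) (f : {linear M -> N}) (g : {linear N -> N'})
    (f' : {linear M -> M'}) (g' : {linear M' -> N'}) :
  (forall x, g (f x) = g' (f' x)) ->
  homotopic (chain_comp (res_map g) (res_map f)) (chain_comp (res_map g') (res_map f')).
Proof.
move=> e; apply: comparison_uniq (@res_cx_nonpos _) _ _ _ (res_epsP _) _ _ _ => x.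
by rewrite /= !res_eps_natural e.
Qed.

(* A homotopy at the level of resolutions gives a map of cones strictly
   compatible with [cone_proj]; the comparison theorem shows that it is also
   compatible with the identification with res M''. *)
Lemma res_boundary_natural (S T : ses A) (a : ses_hom S T) wS wT :
  res_boundary wS -> res_boundary wT ->
  homotopic (chain_comp (shift_map 1 (res_map (ses_hom_sub a))) wS)
    (chain_comp wT (res_map (ses_hom_quo a))).
Proof.
move=> [kS kSE ->] [kT kTE ->].
have sq : homotopic (chain_comp (res_map (ses_hom_mid a)) (res_map (ses_inj S)))
    (chain_comp (res_map (ses_inj T)) (res_map (ses_hom_sub a))).
  by apply: res_square => x; rewrite ses_hom_inj.
have [c [_ prc c2]] := cone_map_exists sq.
rewrite chain_compA -prc -!chain_compA; apply: homotopic_compr.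
apply: comparison_uniq (@res_cx_nonpos _) _ _ _ (res_cone_resolution T) _ _ _ => x.
(* In degree 0 the first summand of the cone is zero, so the homotopy used to build [c] does not
   contribute to the augmentation. *)
rewrite [RHS]kTE res_eps_natural -kSE /= c2 ?res_eps_natural ?ses_hom_proj //.
by apply: res_cx_nonpos.
Qed.

Definition tate_eps (M : lmodType A) : chain_map (tate_cx eR res M) (res_cx M) :=
  counit eR_adj (res M).

Lemma tate_eps_coreflection M : coreflection (tate_eps M).
Proof. exact: counit_coreflection. Qed.

Lemma tate_eps_natural (M M' : lmodType A) (f : {linear M -> M'}) :
  homotopic (chain_comp (tate_eps M') (tate_cx_map eR res f))
    (chain_comp (res_map f) (tate_eps M)).
Proof. exact: counit_natural. Qed.

(* [tate_cx] hides the object of E(A) that [coreflection_uniq] needs. *)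
Lemma tate_uniq (M : lmodType A) (Y X : complex A) (eps : chain_map Y X)
    (v v' : chain_map (tate_cx eR res M) Y) :
  coreflection eps -> homotopic (chain_comp eps v) (chain_comp eps v') ->
  homotopic v v'.
Proof. exact: (@coreflection_uniq _ _ _ _ (eR (res M))). Qed.

Lemma tate_square (M N M' N' : lmodType A) (f : {linear M -> N}) (g : {linear N -> N'})
    (f' : {linear M -> M'}) (g' : {linear M' -> N'}) :
  (forall x, g (f x) = g' (f' x)) ->
  homotopic (chain_comp (tate_cx_map eR res g) (tate_cx_map eR res f))
    (chain_comp (tate_cx_map eR res g') (tate_cx_map eR res f')).
Proof.
move=> e; apply: tate_uniq (tate_eps_coreflection N') _.
have reduce (L : lmodType A) (h : {linear M -> L}) (k : {linear L -> N'}) :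
    homotopic (chain_comp (tate_eps N')
        (chain_comp (tate_cx_map eR res k) (tate_cx_map eR res h)))
      (chain_comp (chain_comp (res_map k) (res_map h)) (tate_eps M)).
  rewrite chain_compA; apply: homotopic_trans (homotopic_compl _ (tate_eps_natural k)) _.
  by rewrite -!chain_compA; exact/homotopic_compr/tate_eps_natural.
apply: homotopic_trans (reduce _ f g) (homotopic_trans _ (homotopic_sym (reduce _ f' g'))).
exact/homotopic_compl/res_square.
Qed.

Definition tate_boundary (S : ses A)
    (u : chain_map (tate_cx eR res (ses_quo S))
           (shift 1 (tate_cx eR res (ses_sub S)))) :=
  exists2 w, res_boundary w &
    homotopic (chain_comp (shift_map 1 (tate_eps (ses_sub S))) u)
      (chain_comp w (tate_eps (ses_quo S))).

Lemma tate_boundary_natural (S T : ses A) (a : ses_hom S T) uS uT :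
  tate_boundary uS -> tate_boundary uT ->
  homotopic (chain_comp (shift_map 1 (tate_cx_map eR res (ses_hom_sub a))) uS)
    (chain_comp uT (tate_cx_map eR res (ses_hom_quo a))).
Proof.
move=> [wS bS hS] [wT bT hT].
apply: tate_uniq (shift_coreflection 1 (tate_eps_coreflection _)) _.
rewrite !chain_compA -shift_comp.
apply: homotopic_trans (homotopic_compl _ (shift_homotopic 1 (tate_eps_natural _))) _.
apply: homotopic_trans _ (homotopic_compl _ (homotopic_sym hT)).
rewrite shift_comp -!chain_compA.
apply: homotopic_trans (homotopic_compr _ hS) _.
apply: homotopic_trans _ (homotopic_compr _ (homotopic_sym (tate_eps_natural _))).
by rewrite !chain_compA; exact/homotopic_compl/res_boundary_natural.
Qed.

(** Both [c] and the counit at the quotient are coreflections with totally acyclic source, so the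
    equivalence between the cone and the resolution of the quotient lifts to their sources. *)
Lemma tate_triangle (S : ses A) : exists2 u, tate_boundary u &
  triangle (tate_cx_map eR res (ses_inj S)) (tate_cx_map eR res (ses_proj S)) u.
Proof.
have [w bw [k [l [lk kl kp kw]]]] := res_triangle S.
have sq := tate_eps_natural (ses_inj S).
have [c [cj cpr _]] := cone_map_exists sq.
have cc : coreflection c.
  exact: cone_coreflection sq cj cpr (tate_eps_coreflection _) (tate_eps_coreflection _).
have ceps := tate_eps_coreflection (ses_quo S).
pose fE := tate_cx_map eR res (ses_inj S).
(* The cone must itself be a test object: [lE] and the homotopy from [kE lE] to the identity have it
   as source. *)
pose CE : EPro A := @coneE _ (eR (res (ses_sub S))) (eR (res (ses_mid S))) fE.
have [kE kEE] := cc.1 (eR (res (ses_quo S))) (chain_comp k (tate_eps _)).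
have [lE lEE] := ceps.1 CE (chain_comp l c).
exists (chain_comp (cone_proj fE) kE).
  exists w => //; rewrite chain_compA -cpr -chain_compA.
  apply: homotopic_trans (homotopic_compr _ kEE) _.
  by rewrite chain_compA; exact: homotopic_compl.
exists kE, lE; split.
- apply: tate_uniq ceps _; rewrite chain_comp1r chain_compA.
  apply: homotopic_trans (homotopic_compl _ lEE) _; rewrite -chain_compA.
  apply: homotopic_trans (homotopic_compr _ kEE) _; rewrite chain_compA.
  by rewrite -[X in homotopic _ X]chain_comp1l; exact: homotopic_compl.
- apply: (@coreflection_uniq _ _ _ _ CE) cc _; rewrite chain_comp1r chain_compA.
  apply: homotopic_trans (homotopic_compl _ kEE) _; rewrite -chain_compA.
  apply: homotopic_trans (homotopic_compr _ lEE) _; rewrite chain_compA.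
  by rewrite -[X in homotopic _ X]chain_comp1l; exact: homotopic_compl.
- apply: tate_uniq cc _; rewrite chain_compA cj.
  apply: homotopic_trans (homotopic_compl _ kEE) _; rewrite -chain_compA.
  apply: homotopic_trans (homotopic_compr _ (tate_eps_natural _)) _.
  by rewrite chain_compA; exact: homotopic_compl.
- exact: homotopic_refl.
Qed.

End Triangles.

(** * Cohomology of Hom complexes *)

Section CohomologyClass.
Variables (C : abcomplex) (i : int).

Lemma cohomology_class_surj (h : cohomology C i) : exists z, h = cohomology_class z.
Proof. by exists (repr h); rewrite /cohomology_class reprK. Qed.

Lemma cohomology_classB (z w : cocycle C i) :
  cohomology_class (z - w) = cohomology_class z - cohomology_class w.
Proof. by rewrite /cohomology_class raddfB. Qed.

Lemma cohomology_class_eq0 (z : cocycle C i) j : j + 1 = i ->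
  cohomology_class z = 0 <-> exists y : C j, abd C j i y = cocycle_val z.
Proof.
move=> ji; have -> : j = i - 1 by lia.
have -> : 0 = cohomology_class (0 : cocycle C i) by rewrite /cohomology_class raddf0.
split=> [/eqP|h].
  by rewrite /cohomology_class -Quotient.idealrBE subr0 unfold_in => /asboolP.
apply/eqP; rewrite /cohomology_class -Quotient.idealrBE subr0 unfold_in.
exact/asboolP.
Qed.

End CohomologyClass.

Section HomClass.
Variable A : pzRingType.

Section Def.
Variables (X : complex A) (N : lmodType A) (i : int).

Definition hom_cocycle (g : {linear X (- i) -> N}) :=
  forall x, g (cd X (- (i + 1)) (- i) x) = 0.

Fact hom_class_subproof (g : {linear X (- i) -> N}) :
  hom_cocycle g -> (g : homcx X N i) \in @is_cocycle (homcx X N) i.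
Proof. by move=> gP; rewrite unfold_in; apply/eqP/linear_ext => x; exact: gP. Qed.

Definition hom_class g (gP : hom_cocycle g) : cohomology (homcx X N) i :=
  cohomology_class (Cocycle (hom_class_subproof gP)).

Lemma hom_class_surj (h : cohomology (homcx X N) i) :
  exists g (gP : hom_cocycle g), h = hom_class gP.
Proof.
have [[g gP] ->] := cohomology_class_surj h; exists g.
have gd : hom_cocycle g.
  move=> x; move/eqP: (gP); exact: (congr1 (fun u : linhom _ _ => u x)).
by exists gd; congr cohomology_class; apply: val_inj.
Qed.

Lemma hom_class_eq0 g (gP : hom_cocycle g) j : j + 1 = i ->
  hom_class gP = 0 <->
  exists y : {linear X (- j) -> N}, forall x, y (cd X (- i) (- j) x) = g x.
Proof.
move=> ji; split=> [/(cohomology_class_eq0 _ ji)[y yE]|[y yE]].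
  by exists y => x; exact: (congr1 (fun u : linhom _ _ => u x) yE).
apply/(cohomology_class_eq0 _ ji); exists y.
by apply: linear_ext => x; exact: yE.
Qed.

Lemma hom_cocycle_cd g k x : hom_cocycle g -> g (cd X k (- i) x) = 0.
Proof.
move=> gP; have [e|ne] := eqVneq (- i) (k + 1); last by rewrite cd_shape ?raddf0.
have ek : k = - (i + 1) by lia.
by subst k; exact: gP.
Qed.

Lemma hom_class_ext g g' (gP : hom_cocycle g) (gP' : hom_cocycle g') :
  g =1 g' -> hom_class gP = hom_class gP'.
Proof.
move=> e; congr cohomology_class; apply: val_inj => /=.
by apply: linear_ext => x; exact: e.
Qed.

Lemma hom_cocycleB g g' : hom_cocycle g -> hom_cocycle g' ->
  hom_cocycle (linhom_add g (linhom_opp g')).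
Proof. by move=> gP gP' x; rewrite /= gP gP' subr0. Qed.

Lemma hom_classB g g' (gP : hom_cocycle g) (gP' : hom_cocycle g') :
  hom_class (hom_cocycleB gP gP') = hom_class gP - hom_class gP'.
Proof.
rewrite /hom_class -cohomology_classB; congr cohomology_class.
by apply: val_inj; apply: linear_ext.
Qed.

Lemma hom_class_eq g g' (gP : hom_cocycle g) (gP' : hom_cocycle g') j :
  j + 1 = i ->
  hom_class gP = hom_class gP' <->
  exists y : {linear X (- j) -> N}, forall x, y (cd X (- i) (- j) x) = g x - g' x.
Proof.
move=> ji; split=> [e|h].
  by apply/(hom_class_eq0 (hom_cocycleB gP gP') ji); rewrite hom_classB e subrr.
by apply/subr0_eq; rewrite -hom_classB; apply/(hom_class_eq0 _ ji).
Qed.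

End Def.

(** Turns a diagram chase with choices, recorded as a relation on cocycles, into an additive map.
    Compatibility with subtraction reduces independence of the choices to the case of the zero
    class. *)
Lemma induced_hom_map (X Y : complex A) (N N' : lmodType A) i j
    (R : {linear X (- i) -> N} -> {linear Y (- j) -> N'} -> Prop) :
  (forall g, hom_cocycle g -> exists2 w, hom_cocycle w & R g w) ->
  (forall g w g' w', R g w -> R g' w' ->
     R (linhom_add g (linhom_opp g')) (linhom_add w (linhom_opp w'))) ->
  (forall g w (gP : hom_cocycle g) (wP : hom_cocycle w), R g w ->
     hom_class gP = 0 -> hom_class wP = 0) ->
  exists phi : {additive cohomology (homcx X N) i -> cohomology (homcx Y N') j},
    forall g w (gP : hom_cocycle g) (wP : hom_cocycle w), R g w ->
      phi (hom_class gP) = hom_class wP.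
Proof.
move=> total sub zero.
have wd g w g' w' (gP : hom_cocycle g) (wP : hom_cocycle w) (gP' : hom_cocycle g')
    (wP' : hom_cocycle w') : R g w -> R g' w' ->
    hom_class gP = hom_class gP' -> hom_class wP = hom_class wP'.
  move=> r r' e; apply/subr0_eq; rewrite -hom_classB.
  apply: zero (hom_cocycleB gP gP') _ (sub _ _ _ _ r r') _.
  by rewrite hom_classB e subrr.
have val h : {k | forall g w (gP : hom_cocycle g) (wP : hom_cocycle w), R g w ->
    h = hom_class gP -> k = hom_class wP}.
  apply: cid; have [g [gP ->]] := hom_class_surj h; have [w wP r] := total g gP.
  by exists (hom_class wP) => g' w' gP' wP' r' e; exact: wd r r' e.
pose phi h := sval (val h).
have phiE g w (gP : hom_cocycle g) (wP : hom_cocycle w) : R g w ->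
    phi (hom_class gP) = hom_class wP.
  by move=> r; rewrite /phi; case: (val _) => k /= kE; exact: kE r _.
have phiB : zmod_morphism phi.
  move=> h h'; have [g [gP ->]] := hom_class_surj h.
  have [g' [gP' ->]] := hom_class_surj h'.
  have [w wP r] := total g gP; have [w' wP' r'] := total g' gP'.
  by rewrite -hom_classB (phiE _ _ _ (hom_cocycleB wP wP') (sub _ _ _ _ r r'))
    hom_classB (phiE _ _ _ _ r) (phiE _ _ _ _ r').
pose add := GRing.isZmodMorphism.Build _ _ phi phiB.
pose psi : {additive _ -> _} := HB.pack phi add.
by exists psi.
Qed.

Definition homl i (X Y : complex A) (f : chain_map X Y) (N : lmodType A) :
    {additive cohomology (homcx Y N) i -> cohomology (homcx X N) i} :=
  cohomology_map (homcx_mapl f N) (i := i).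

Definition homr i (X : complex A) (N N' : lmodType A) (u : {linear N -> N'}) :
    {additive cohomology (homcx X N) i -> cohomology (homcx X N') i} :=
  cohomology_map (homcx_mapr X u) (i := i).

Section Maps.
Variable i : int.

Lemma homl_class (X Y : complex A) (f : chain_map X Y) (N : lmodType A) g
    (gP : @hom_cocycle Y N i g)
    (gP' : @hom_cocycle X N i (lin_comp g (f (- i)))) :
  homl i f N (hom_class gP) = hom_class gP'.
Proof.
rewrite [LHS]cohomology_map_class; congr cohomology_class.
by apply: val_inj; apply: linear_ext.
Qed.

Lemma hom_cocycle_compl (X Y : complex A) (f : chain_map X Y) N g :
  @hom_cocycle Y N i g -> @hom_cocycle X N i (lin_comp g (f (- i))).
Proof. by move=> gP x; rewrite /= chain_mapP gP. Qed.

Lemma homr_class (X : complex A) (N N' : lmodType A) (u : {linear N -> N'}) g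
    (gP : @hom_cocycle X N i g)
    (gP' : @hom_cocycle X N' i (lin_comp u g)) :
  homr i X u (hom_class gP) = hom_class gP'.
Proof.
rewrite [LHS]cohomology_map_class; congr cohomology_class.
by apply: val_inj; apply: linear_ext.
Qed.

Lemma hom_cocycle_compr (X : complex A) (N N' : lmodType A) (u : {linear N -> N'}) g :
  @hom_cocycle X N i g -> @hom_cocycle X N' i (lin_comp u g).
Proof. by move=> gP x; rewrite /= gP raddf0. Qed.

Lemma homl_homotopic (X Y : complex A) (f f' : chain_map X Y) N :
  homotopic f f' -> homl i f N =1 homl i f' N.
Proof.
move=> /homotopicP[s hs] h; have [g [gP ->]] := hom_class_surj h.
rewrite (homl_class gP (hom_cocycle_compl f gP)) (homl_class gP (hom_cocycle_compl f' gP)).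
apply/(hom_class_eq _ _ (_ : (i - 1) + 1 = i)); first by lia.
exists (lin_comp g (s (- (i - 1)) (- i))) => x /=.
rewrite -linearB (hs _ (- (i + 1)) (- (i - 1))); [|lia|lia].
by rewrite linearD gP add0r.
Qed.

Lemma homl_id (X : complex A) N : homl i (chain_id X) N =1 id.
Proof.
move=> h; have [g [gP ->]] := hom_class_surj h.
by rewrite (homl_class gP (hom_cocycle_compl _ gP)); exact: hom_class_ext.
Qed.

Lemma homl_comp (X Y Z : complex A) (g : chain_map Y Z) (f : chain_map X Y) N h :
  homl i (chain_comp g f) N h = homl i f N (homl i g N h).
Proof.
have [z [zP ->]] := hom_class_surj h.
rewrite (homl_class zP (hom_cocycle_compl g zP)).
rewrite (homl_class _ (hom_cocycle_compl f (hom_cocycle_compl g zP))).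
by rewrite (homl_class zP (hom_cocycle_compl _ zP)); exact: hom_class_ext.
Qed.

Lemma homl_0 (X Y : complex A) N h : homl i (0 : chain_map X Y) N h = 0.
Proof.
have [z [zP ->]] := hom_class_surj h.
rewrite (homl_class zP (hom_cocycle_compl _ zP)).
apply/(hom_class_eq0 _ (_ : (i - 1) + 1 = i)); first by lia.
by exists (linhom_zero _ _) => x /=; rewrite raddf0.
Qed.

Lemma homr_comp (X : complex A) (N N' N'' : lmodType A)
    (v : {linear N' -> N''}) (u : {linear N -> N'}) (w : {linear N -> N''}) h :
  (forall x, w x = v (u x)) -> homr i X w h = homr i X v (homr i X u h).
Proof.
move=> e; have [z [zP ->]] := hom_class_surj h.
rewrite (homr_class zP (hom_cocycle_compr u zP)).
rewrite (homr_class _ (hom_cocycle_compr v (hom_cocycle_compr u zP))).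
rewrite (homr_class zP (hom_cocycle_compr _ zP)).
by apply: hom_class_ext => x; rewrite /= e.
Qed.

Lemma homlr (X Y : complex A) (f : chain_map X Y) (N N' : lmodType A)
    (u : {linear N -> N'}) h :
  homl i f N' (homr i Y u h) = homr i X u (homl i f N h).
Proof.
have [z [zP ->]] := hom_class_surj h.
rewrite (homr_class zP (hom_cocycle_compr u zP)).
rewrite (homl_class zP (hom_cocycle_compl f zP)).
rewrite (homr_class _ (hom_cocycle_compr u (hom_cocycle_compl f zP))).
rewrite (homl_class _ (hom_cocycle_compl f (hom_cocycle_compr u zP))).
exact: hom_class_ext.
Qed.

End Maps.

Section ShiftClass.
Variable i : int.

(** Degree i + 1 of Hom(shift 1 X, N) is Hom(X^{-(i + 1) + 1}, N), which differs from degree i of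
    Hom(X, N) by a cast only. *)
Definition shift_cochain (X : complex A) (N : lmodType A) (z : {linear X (- i) -> N}) :
    {linear shift 1 X (- (i + 1)) -> N} :=
  lin_comp z (deg_cast X (- (i + 1) + 1) (- i)).

Lemma shift_cochainP (X : complex A) N z :
  @hom_cocycle X N i z -> @hom_cocycle (shift 1 X) N (i + 1) (shift_cochain z).
Proof.
move=> zP x; rewrite /= !linearN deg_cast_cd; last by lia.
by rewrite hom_cocycle_cd ?oppr0.
Qed.

Lemma shift_class_exists (X : complex A) (N : lmodType A) :
  exists sigma : {additive cohomology (homcx X N) i ->
                           cohomology (homcx (shift 1 X) N) (i + 1)},
    forall (z : {linear X (- i) -> N}) (zP : hom_cocycle z),
      sigma (hom_class zP) = hom_class (shift_cochainP zP).
Proof.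
have [|||phi phiE] := @induced_hom_map X (shift 1 X) N N i (i + 1)
  (fun z w => w =1 shift_cochain z).
- by move=> z zP; exists (shift_cochain z) => //; exact: shift_cochainP.
- by move=> z w z' w' /= e e' x; rewrite /= e e'.
- move=> z w zP wP e /(hom_class_eq0 _ (_ : (i - 1) + 1 = i))[]; first by lia.
  move=> y yE; apply/(hom_class_eq0 _ (erefl (i + 1))).
  (* The sign compensates the negated differential of the shift. *)
  exists (linhom_opp (lin_comp y (deg_cast X (- i + 1) (- (i - 1))))) => x.
  rewrite /= linearN linearN opprK deg_cast_cd; last by lia.
  by rewrite e /= -yE cd_deg_cast //; lia.
by exists phi => z zP; exact: phiE.
Qed.

Definition shift_class (X : complex A) (N : lmodType A) :
    {additive cohomology (homcx X N) i -> cohomology (homcx (shift 1 X) N) (i + 1)} :=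
  sval (cid (shift_class_exists X N)).

Lemma shift_classE (X : complex A) (N : lmodType A)
    (z : {linear X (- i) -> N}) (zP : hom_cocycle z) :
  shift_class X N (hom_class zP) = hom_class (shift_cochainP zP).
Proof. by rewrite /shift_class; case: (cid _). Qed.

Lemma shift_class_homl (X Y : complex A) (f : chain_map X Y) (N : lmodType A) h :
  shift_class X N (homl i f N h) = homl (i + 1) (shift_map 1 f) N (shift_class Y N h).
Proof.
have [z [zP ->]] := hom_class_surj h.
rewrite (homl_class zP (hom_cocycle_compl f zP)) !shift_classE.
rewrite (homl_class _ (hom_cocycle_compl (shift_map 1 f) (shift_cochainP zP))).
by apply: hom_class_ext => x /=; rewrite chain_deg_cast.
Qed.

Lemma shift_class_homr (X : complex A) (N N' : lmodType A) (u : {linear N -> N'}) h :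
  shift_class X N' (homr i X u h) = homr (i + 1) (shift 1 X) u (shift_class X N h).
Proof.
have [z [zP ->]] := hom_class_surj h.
rewrite (homr_class zP (hom_cocycle_compr u zP)) !shift_classE.
rewrite (homr_class _ (hom_cocycle_compr u (shift_cochainP zP))).
exact: hom_class_ext.
Qed.

(** * The cohomology sequence of a cone under Hom(-, N) *)

Section ConeSequence.
Variables (X Y : complex A) (f : chain_map X Y) (N : lmodType A).

Lemma cone_boundary_class (z : {linear X (- i) -> N}) (zP : hom_cocycle z) :
  homl (i + 1) (cone_proj f) N (shift_class X N (hom_class zP)) =
  hom_class (hom_cocycle_compl (cone_proj f) (shift_cochainP zP)).
Proof. by rewrite shift_classE; exact: homl_class. Qed.

(** For a cochain (y1, y2) on the cone, the equation that its coboundary is z composed with the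
    projection says that y2 is a cocycle on [Y] and that y2 f - z = y1 d. *)
Lemma hom_cone_exact1 :
  exact_at (homl i f N) (fun v => homl (i + 1) (cone_proj f) N (shift_class X N v)).
Proof.
move=> v; have [z [zP ->]] := hom_class_surj v; rewrite cone_boundary_class; split.
  move=> /(hom_class_eq0 _ (erefl (i + 1)))[y yE].
  pose y1 := lin_comp y (lin_pair (lin_id (X (- i + 1))) (linhom_zero _ (Y (- i)))).
  pose y2 := lin_comp y (lin_pair (linhom_zero _ (X (- i + 1))) (lin_id (Y (- i)))).
  have y2P : hom_cocycle y2.
    move=> b; have := yE (0, b); rewrite /= !raddf0 add0r => <-.
    by rewrite /y2 /=.
  exists (hom_class y2P); rewrite (homl_class y2P (hom_cocycle_compl f y2P)).
  apply/(hom_class_eq _ _ (_ : (i - 1) + 1 = i)); first by lia.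
  exists (lin_comp y1 (deg_cast X (- (i - 1)) (- i + 1))) => x /=.
  rewrite deg_cast_cd; last by lia.
  have := yE (deg_cast X (- i) (- (i + 1) + 1) x, 0).
  rewrite /= raddf0 addr0 deg_castK; last by lia.
  move=> <-; apply/eqP; rewrite eq_sym subr_eq; apply/eqP.
  rewrite cd_deg_cast; last by lia.
  rewrite -chain_deg_cast deg_castK; last by lia.
  by rewrite -linearD; congr (y _); congr (_, _); rewrite ?subrr ?add0r.
case=> u; have [g [gP ->]] := hom_class_surj u.
rewrite (homl_class gP (hom_cocycle_compl f gP)).
move=> /(hom_class_eq _ _ (_ : (i - 1) + 1 = i))[]; first by lia.
move=> y yE; apply/(hom_class_eq0 _ (erefl (i + 1))).
exists (linhom_add (lin_comp g (lin_snd _ _)) 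
  (lin_comp y (lin_comp (deg_cast X (- i + 1) (- (i - 1))) (lin_fst _ _)))).
case=> x b; rewrite /= linearD gP addr0 linearN linearN.
rewrite deg_cast_cd; last by lia.
rewrite -[cd X _ (- (i - 1)) x](@cd_deg_cast _ _ _ (- i)); last by lia.
by rewrite yE -chain_deg_cast opprB addrC subrK.
Qed.

(** If the cocycle c = (c1, c2) has c2 = y d, subtracting the coboundary of (0, y) leaves (c1 - y f,
    0), which comes from the shift of [X]. *)
Lemma hom_cone_exact2 :
  exact_at (fun v => homl (i + 1) (cone_proj f) N (shift_class X N v))
    (homl (i + 1) (cone_inj f) N).
Proof.
move=> v; have [c [cP ->]] := hom_class_surj v; split; last first.
  case=> u <-; rewrite -homl_comp.
  rewrite (homl_homotopic (f' := 0)) ?homl_0 //; apply: homotopic_eq.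
  exact: chain_map_ext.
rewrite (homl_class cP (hom_cocycle_compl (cone_inj f) cP)).
move=> /(hom_class_eq0 _ (erefl (i + 1)))[y yE].
pose z := linhom_add
  (lin_comp c (lin_comp (lin_pair (lin_id _) (linhom_zero _ (Y (- (i + 1)))))
    (deg_cast X (- i) (- (i + 1) + 1))))
  (linhom_opp (lin_comp y (f (- i)))).
have zP : hom_cocycle z.
  move=> x; rewrite /z /= deg_cast_cd; last by lia.
  rewrite chain_mapP yE /=.
  have := cP (deg_cast X (- (i + 1)) (- (i + 1 + 1) + 1) x, 0).
  rewrite /= raddf0 addr0 -chain_deg_cast deg_castK; last by lia.
  rewrite cd_deg_cast; last by lia.
  move=> e; apply: oppr_inj; rewrite oppr0 -[RHS]e -linearB -linearN; congr (c _).
  by congr (_, _); rewrite /= ?subr0 ?sub0r ?opprK.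
exists (hom_class zP); rewrite cone_boundary_class.
apply/(hom_class_eq _ _ (erefl (i + 1))).
exists (linhom_opp (lin_comp y (lin_snd _ _))) => -[x b].
rewrite /= deg_castK; last by lia.
rewrite linearD yE /= -chain_deg_cast addrAC opprD addrC; congr (_ + _).
rewrite -linearN -linearB; congr (c _).
by congr (_, _); rewrite /= ?subrr ?sub0r ?oppr0.
Qed.

(** If g f = y d, then (y, g) is a cocycle on the cone that restricts to g. *)
Lemma hom_cone_exact3 : exact_at (homl i (cone_inj f) N) (homl i f N).
Proof.
move=> v; split; last first.
  case=> u <-; rewrite -homl_comp.
  by rewrite (homl_homotopic (cone_inj_null f)) homl_0.
have [g [gP ->]] := hom_class_surj v.
rewrite (homl_class gP (hom_cocycle_compl f gP)).
move=> /(hom_class_eq0 _ (_ : (i - 1) + 1 = i))[]; first by lia.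
move=> y yE.
pose c : {linear cone f (- i) -> N} := linhom_add
  (lin_comp y (lin_comp (deg_cast X (- i + 1) (- (i - 1))) (lin_fst _ _)))
  (lin_comp g (lin_snd _ _)).
have cP : hom_cocycle c.
  case=> x b; rewrite /c /= linearN linearN deg_cast_cd; last by lia.
  rewrite linearD gP addr0 -chain_deg_cast.
  rewrite -[cd X _ (- (i - 1)) x](@cd_deg_cast _ _ _ (- i)); last by lia.
  by rewrite yE addNr.
exists (hom_class cP).
rewrite (homl_class cP (hom_cocycle_compl (cone_inj f) cP)).
by apply: hom_class_ext => b; rewrite /c /= !raddf0 add0r.
Qed.

End ConeSequence.

End ShiftClass.

(** The equivalence with the cone induces inverse isomorphisms on cohomology, which carry the cone
    sequence over. *)
Lemma triangle_exact (X' X X'' : complex A) (f : chain_map X' X) (p : chain_map X X'')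
    (w : chain_map X'' (shift 1 X')) (N : lmodType A) i :
  triangle f p w ->
  let delta v := homl (i + 1) w N (shift_class i X' N v) in
  [/\ exact_at (homl i p N) (homl i f N), exact_at (homl i f N) delta
    & exact_at delta (homl (i + 1) p N)].
Proof.
move=> [k [l [lk kl kp kw]]] delta.
have lkE j h : homl j k N (homl j l N h) = h.
  by rewrite -homl_comp (homl_homotopic lk) homl_id.
have klE j h : homl j l N (homl j k N h) = h.
  by rewrite -homl_comp (homl_homotopic kl) homl_id.
have kpE j h : homl j p N (homl j k N h) = homl j (cone_inj f) N h.
  by rewrite -homl_comp (homl_homotopic kp).
have deltaE v : delta v = homl _ k N (homl _ (cone_proj f) N (shift_class i X' N v)).
  by rewrite /delta -homl_comp (homl_homotopic kw).
split=> v.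
- split=> [/hom_cone_exact3[u <-]|[u <-]].
    by exists (homl i k N u); rewrite kpE.
  by apply/hom_cone_exact3; exists (homl i l N u); rewrite -kpE lkE.
- rewrite deltaE; split=> [e|/hom_cone_exact1 ->]; last by rewrite raddf0.
  apply/hom_cone_exact1; have := congr1 (homl (i + 1) l N) e.
  by rewrite klE raddf0.
- rewrite -[v]lkE kpE; split=> [/hom_cone_exact2[u uE]|[u]].
    by exists u; rewrite deltaE uE.
  rewrite deltaE => /(congr1 (homl (i + 1) l N)); rewrite !klE => e.
  by apply/hom_cone_exact2; exists u.
Qed.

End HomClass.

(** * The connecting map in the second variable *)

Section Snake.
Variable A : pzRingType.

Section Boundary.
Variables (X : procomplex A) (S : ses A) (i : int).

(* [w] represents the connecting map at [g]: lift g to t, apply the differential,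
   and factor the result through the kernel. *)
Definition snake (g : {linear X (- i) -> ses_quo S})
    (w : {linear X (- (i + 1)) -> ses_sub S}) :=
  exists2 t : {linear X (- i) -> ses_mid S}, forall x, ses_proj S (t x) = g x &
    forall x, ses_inj S (w x) = t (cd X (- (i + 1)) (- i) x).

Lemma lift_proj k (g : {linear X k -> ses_quo S}) :
  exists t : {linear X k -> ses_mid S}, forall x, ses_proj S (t x) = g x.
Proof. exact: pro_projective (@ses_proj_surj _ S). Qed.

Lemma lift_inj k (t : {linear X k -> ses_mid S}) :
  (forall x, ses_proj S (t x) = 0) ->
  exists w : {linear X k -> ses_sub S}, forall x, ses_inj S (w x) = t x.
Proof.
by move=> pt; apply: projective_lift_image (@pro_projective A X k) _ => x; apply/ses_exact.
Qed.

Lemma snake_cocycle g w : snake g w -> hom_cocycle w.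
Proof.
move=> [t _ wE] x; apply: (@ses_inj_inj _ S).
by rewrite wE cdd !raddf0.
Qed.

Lemma snake_total g : hom_cocycle g -> exists w, snake g w.
Proof.
move=> gP; have [t tE] := lift_proj g.
have [|w wE] := @lift_inj _ (lin_comp t (cd X (- (i + 1)) (- i))).
  by move=> x; rewrite /= tE gP.
by exists w, t.
Qed.

Lemma snake_map_exists :
  exists delta : {additive cohomology (homcx X (ses_quo S)) i ->
                           cohomology (homcx X (ses_sub S)) (i + 1)},
    forall g w (gP : hom_cocycle g) (wP : hom_cocycle w), snake g w ->
      delta (hom_class gP) = hom_class wP.
Proof.
apply: induced_hom_map => [g gP|g w g' w' [t tE wE] [t' tE' wE']|g w gP wP [t tE wE]].
- by have [w gw] := snake_total gP; exists w => //; exact: snake_cocycle gw.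
- exists (linhom_add t (linhom_opp t')) => x /=; first by rewrite linearB tE tE'.
  by rewrite linearB wE wE'.
- move=> /(hom_class_eq0 _ (_ : (i - 1) + 1 = i))[]; first by lia.
  move=> y yE; have [y' y'E] := lift_proj y.
  (* Since g = y d, the difference t - y' d lands in the submodule, and its factorization v
     satisfies v d = w. *)
  have [|v vE] := @lift_inj _ (linhom_add t
      (linhom_opp (lin_comp y' (cd X (- i) (- (i - 1)))))).
    by move=> x; rewrite /= linearB tE y'E yE subrr.
  apply/(hom_class_eq0 _ (erefl (i + 1))); exists v => x.
  by apply: (@ses_inj_inj _ S); rewrite vE /= cdd raddf0 subr0 wE.
Qed.

Definition snake_map : {additive cohomology (homcx X (ses_quo S)) i ->
    cohomology (homcx X (ses_sub S)) (i + 1)} := sval (cid snake_map_exists).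

Lemma snake_mapE g w (gP : hom_cocycle g) (wP : hom_cocycle w) :
  snake g w -> snake_map (hom_class gP) = hom_class wP.
Proof. by rewrite /snake_map; case: (cid _) => /= d dE; exact: dE. Qed.

Lemma snake_exact :
  [/\ exact_at (homr i X (ses_inj S)) (homr i X (ses_proj S)),
      exact_at (homr i X (ses_proj S)) snake_map
    & exact_at snake_map (homr (i + 1) X (ses_inj S))].
Proof.
have i1 : i - 1 + 1 = i by lia.
split=> v; have [g [gP ->]] := hom_class_surj v.
- rewrite (homr_class gP (hom_cocycle_compr (ses_proj S) gP)); split.
    move=> /(hom_class_eq0 _ i1)[y yE]; have [y' y'E] := lift_proj y.
    have [|w wE] := @lift_inj _ (linhom_add g
        (linhom_opp (lin_comp y' (cd X (- i) (- (i - 1)))))).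
      by move=> x; rewrite /= linearB y'E yE subrr.
    have wP : hom_cocycle w.
      by move=> x; apply: (@ses_inj_inj _ S); rewrite wE /= cdd gP !raddf0 addr0.
    exists (hom_class wP); rewrite (homr_class wP (hom_cocycle_compr _ wP)).
    apply/(hom_class_eq _ _ i1); exists (linhom_opp y') => x.
    by rewrite /= wE /= addrAC subrr sub0r.
  case=> u; have [w [wP ->]] := hom_class_surj u => uE.
  rewrite (homr_class wP (hom_cocycle_compr (ses_inj S) wP)) in uE.
  rewrite -(homr_class gP (hom_cocycle_compr (ses_proj S) gP)) -uE.
  rewrite (homr_class _ (hom_cocycle_compr _ (hom_cocycle_compr _ wP))).
  apply/(hom_class_eq0 _ i1); exists (linhom_zero _ _) => x /=.
  by apply/esym/ses_exact; eexists.
- have [w [t tE wE]] := snake_total gP.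
  have gw : snake g w by exists t.
  rewrite (snake_mapE gP (snake_cocycle gw) gw); split.
    move=> /(hom_class_eq0 _ (erefl (i + 1)))[y yE].
    (* With w = y d, the lift t is corrected by y to a lift of g that is a cocycle. *)
    have tP : hom_cocycle (linhom_add t (linhom_opp (lin_comp (ses_inj S) y))).
      by move=> x; rewrite /= yE wE subrr.
    exists (hom_class tP); rewrite (homr_class _ (hom_cocycle_compr _ tP)).
    apply: hom_class_ext => x; rewrite /= linearB tE.
    have -> : ses_proj S (ses_inj S (y x)) = 0 by apply/ses_exact; eexists.
    by rewrite subr0.
  case=> u; have [t' [tP' ->]] := hom_class_surj u.
  rewrite (homr_class _ (hom_cocycle_compr _ tP')) => e.
  rewrite -(snake_mapE gP _ gw) -e.
  (* The class of [g] has a representative with the cocycle lift t', so 0 represents the connecting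
     class. *)
  have zP : @hom_cocycle A X (ses_sub S) (i + 1) (linhom_zero _ _) by [].
  rewrite (@snake_mapE _ (linhom_zero _ _) _ zP).
    by apply/(hom_class_eq0 _ (erefl (i + 1))); exists (linhom_zero _ _).
  by exists t' => // x; rewrite /= raddf0 tP'.
- rewrite (homr_class _ (hom_cocycle_compr _ gP)); split.
    move=> /(hom_class_eq0 _ (erefl (i + 1)))[y yE].
    have zP : hom_cocycle (lin_comp (ses_proj S) y).
      by move=> x; rewrite /= yE; apply/ses_exact; eexists.
    by exists (hom_class zP); apply: snake_mapE; exists y.
  case=> u; have [z [zP ->]] := hom_class_surj u.
  have [w zw] := snake_total zP; rewrite (snake_mapE zP (snake_cocycle zw) zw).
  have [t tE wE] := zw => e.
  rewrite -(homr_class gP) -e (homr_class _ (hom_cocycle_compr _ (snake_cocycle zw))).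
  by apply/(hom_class_eq0 _ (erefl (i + 1))); exists t => x; rewrite /= wE.
Qed.

End Boundary.

Lemma snake_map_homr (X : procomplex A) (S T : ses A) (a : ses_hom S T) i h :
  snake_map X T i (homr i X (ses_hom_quo a) h) =
  homr (i + 1) X (ses_hom_sub a) (snake_map X S i h).
Proof.
have [g [gP ->]] := hom_class_surj h; have [w gw] := snake_total gP.
rewrite (snake_mapE gP (snake_cocycle gw) gw).
rewrite (homr_class _ (hom_cocycle_compr _ gP)).
rewrite (homr_class _ (hom_cocycle_compr _ (snake_cocycle gw))).
apply: snake_mapE; have [t tE wE] := gw.
exists (lin_comp (ses_hom_mid a) t) => x /=; first by rewrite ses_hom_proj tE.
by rewrite ses_hom_inj wE.
Qed.

Lemma snake_map_homl (X Y : procomplex A) (f : chain_map X Y) (S : ses A) i h :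
  snake_map X S i (homl i f (ses_quo S) h) =
  homl (i + 1) f (ses_sub S) (snake_map Y S i h).
Proof.
have [g [gP ->]] := hom_class_surj h; have [w gw] := snake_total gP.
rewrite (snake_mapE gP (snake_cocycle gw) gw).
rewrite (homl_class _ (hom_cocycle_compl f gP)).
rewrite (homl_class _ (hom_cocycle_compl f (snake_cocycle gw))).
apply: snake_mapE; have [t tE wE] := gw.
exists (lin_comp t (f (- i))) => x /=; first by rewrite tE.
by rewrite wE chain_mapP.
Qed.

End Snake.

(** * The long exact sequences *)

Section TateSequences.
Variables (A : pzRingType) (eR : functor (KPro A) (EPro A)).
Variables (eR_adj : adjunction (e_incl A) eR) (res : resolution_functor A).

Lemma tate_connecting_exists (S : ses A) : exists u, tate_boundary eR_adj u /\
  triangle (tate_cx_map eR res (ses_inj S)) (tate_cx_map eR res (ses_proj S)) u.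
Proof. by have [u ? ?] := tate_triangle eR_adj res S; exists u. Qed.

Definition tate_connecting (S : ses A) := sval (cid (tate_connecting_exists S)).

Lemma tate_connectingP (S : ses A) : tate_boundary eR_adj (tate_connecting S).
Proof. by rewrite /tate_connecting; case: (cid _) => u []. Qed.

Lemma tate_connecting_triangle (S : ses A) :
  triangle (tate_cx_map eR res (ses_inj S)) (tate_cx_map eR res (ses_proj S))
    (tate_connecting S).
Proof. by rewrite /tate_connecting; case: (cid _) => u []. Qed.

Definition tate_deltal (S : ses A) (N : lmodType A) (i : int) :
    {additive tate_ext eR res i (ses_sub S) N
           -> tate_ext eR res (i + 1) (ses_quo S) N} :=
  (homl (i + 1) (tate_connecting S) N \o shift_class i _ N).

(** Keeps the projectivity that [tate_cx] forgets and the connecting map needs. *)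
Definition tate_pro (M : lmodType A) : procomplex A := sval (eR (res M)).

Definition tate_deltar (M : lmodType A) (S : ses A) (i : int) :
    {additive tate_ext eR res i M (ses_quo S)
           -> tate_ext eR res (i + 1) M (ses_sub S)} :=
  snake_map (tate_pro M) S i.

Lemma tate_extl_square (M M1 M2 M' : lmodType A) (f1 : {linear M -> M1})
    (g1 : {linear M1 -> M'}) (f2 : {linear M -> M2}) (g2 : {linear M2 -> M'})
    (N : lmodType A) i h :
  (forall x, g1 (f1 x) = g2 (f2 x)) ->
  tate_extl eR res i f1 N (tate_extl eR res i g1 N h) =
  tate_extl eR res i f2 N (tate_extl eR res i g2 N h).
Proof.
move=> e; rewrite -[LHS]homl_comp -[RHS]homl_comp.
exact/homl_homotopic/(tate_square eR_adj).
Qed.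

End TateSequences.

Theorem proposition2p3
    (A : pzRingType)
    (eR : functor (KPro A) (EPro A)) (eR_adj : adjunction (e_incl A) eR)
    (res : resolution_functor A) :
  (exists delta : forall (S : ses A) (N : lmodType A) (i : int),
      {additive tate_ext eR res i (ses_sub S) N
             -> tate_ext eR res (i + 1) (ses_quo S) N},
    [/\ (* exactness *)
        forall (S : ses A) (N : lmodType A) (i : int),
        [/\ exact_at (tate_extl eR res i (ses_proj S) N)
                     (tate_extl eR res i (ses_inj S) N),
            exact_at (tate_extl eR res i (ses_inj S) N)
                     (delta S N i)
          & exact_at (delta S N i)
                     (tate_extl eR res (i + 1) (ses_proj S) N)],
        (* naturality in the short exact sequence *)
        forall (S T : ses A) (a : ses_hom S T) (N : lmodType A) (i : int),
        [/\ forall x, tate_extl eR res i (ses_proj S) N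
                        (tate_extl eR res i (ses_hom_quo a) N x)
                    = tate_extl eR res i (ses_hom_mid a) N
                        (tate_extl eR res i (ses_proj T) N x),
            forall x, tate_extl eR res i (ses_inj S) N
                        (tate_extl eR res i (ses_hom_mid a) N x)
                    = tate_extl eR res i (ses_hom_sub a) N
                        (tate_extl eR res i (ses_inj T) N x)
          & forall x, delta S N i (tate_extl eR res i (ses_hom_sub a) N x)
                    = tate_extl eR res (i + 1) (ses_hom_quo a) N
                        (delta T N i x)]
      & (* naturality in the module *)
        forall (S : ses A) (N N' : lmodType A) (u : {linear N -> N'}) (i : int),
        [/\ forall x, tate_extl eR res i (ses_proj S) N'
                        (tate_extr eR res i (ses_quo S) u x)
                    = tate_extr eR res i (ses_mid S) u
                        (tate_extl eR res i (ses_proj S) N x),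
            forall x, tate_extl eR res i (ses_inj S) N'
                        (tate_extr eR res i (ses_mid S) u x)
                    = tate_extr eR res i (ses_sub S) u
                        (tate_extl eR res i (ses_inj S) N x)
          & forall x, delta S N' i (tate_extr eR res i (ses_sub S) u x)
                    = tate_extr eR res (i + 1) (ses_quo S) u
                        (delta S N i x)]])
  /\
  (exists delta : forall (M : lmodType A) (S : ses A) (i : int),
      {additive tate_ext eR res i M (ses_quo S)
             -> tate_ext eR res (i + 1) M (ses_sub S)},
    [/\ (* exactness *)
        forall (M : lmodType A) (S : ses A) (i : int),
        [/\ exact_at (tate_extr eR res i M (ses_inj S))
                     (tate_extr eR res i M (ses_proj S)),
            exact_at (tate_extr eR res i M (ses_proj S))
                     (delta M S i)
          & exact_at (delta M S i)
                     (tate_extr eR res (i + 1) M (ses_inj S))],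
        (* naturality in the short exact sequence *)
        forall (M : lmodType A) (S T : ses A) (a : ses_hom S T) (i : int),
        [/\ forall x, tate_extr eR res i M (ses_inj T)
                        (tate_extr eR res i M (ses_hom_sub a) x)
                    = tate_extr eR res i M (ses_hom_mid a)
                        (tate_extr eR res i M (ses_inj S) x),
            forall x, tate_extr eR res i M (ses_proj T)
                        (tate_extr eR res i M (ses_hom_mid a) x)
                    = tate_extr eR res i M (ses_hom_quo a)
                        (tate_extr eR res i M (ses_proj S) x)
          & forall x, delta M T i (tate_extr eR res i M (ses_hom_quo a) x)
                    = tate_extr eR res (i + 1) M (ses_hom_sub a)
                        (delta M S i x)]
      & (* naturality in the module *)
        forall (M M' : lmodType A) (f : {linear M -> M'}) (S : ses A) (i : int),
        [/\ forall x, tate_extr eR res i M (ses_inj S)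
                        (tate_extl eR res i f (ses_sub S) x)
                    = tate_extl eR res i f (ses_mid S)
                        (tate_extr eR res i M' (ses_inj S) x),
            forall x, tate_extr eR res i M (ses_proj S)
                        (tate_extl eR res i f (ses_mid S) x)
                    = tate_extl eR res i f (ses_quo S)
                        (tate_extr eR res i M' (ses_proj S) x)
          & forall x, delta M S i (tate_extl eR res i f (ses_quo S) x)
                    = tate_extl eR res (i + 1) f (ses_sub S)
                        (delta M' S i x)]]).
Proof.
split.
  exists (tate_deltal eR_adj res); split.
  - by move=> S N i; exact: triangle_exact (tate_connecting_triangle eR_adj res S).
  - move=> S T a N i; split=> x.
    + by apply: (tate_extl_square eR_adj) => y; rewrite ses_hom_proj.
    + by apply: (tate_extl_square eR_adj) => y; rewrite ses_hom_inj.
    (* Once [shift_class] is moved inside, both sides are induced by the two composites of the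
       boundary square, which are homotopic. *)
    + rewrite /= [X in homl _ _ _ X]shift_class_homl -[LHS]homl_comp -[RHS]homl_comp.
      exact/homl_homotopic/(tate_boundary_natural a)/tate_connectingP/tate_connectingP.
  - move=> S N N' u i; split=> x; try exact: homlr.
    rewrite /= [X in homl _ _ _ X]shift_class_homr; exact: homlr.
exists (tate_deltar eR res); split.
- by move=> M S i; exact: snake_exact.
- move=> M S T a i; split=> x; last exact: snake_map_homr.
    rewrite -[LHS](homr_comp _ (w := lin_comp (ses_inj T) (ses_hom_sub a))) //.
    by apply: homr_comp => y; rewrite /= ses_hom_inj.
  rewrite -[LHS](homr_comp _ (w := lin_comp (ses_proj T) (ses_hom_mid a))) //.
  by apply: homr_comp => y; rewrite /= ses_hom_proj.
- move=> M M' f S i; split=> x; last first.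
    exact: (@snake_map_homl _ (tate_pro eR res M) (tate_pro eR res M')).
    exact/esym/homlr.
  exact/esym/homlr.
Qed.
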